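(* Let $1\le k\le n-1$ and let $t(x)\in\mathrm{End}\big(qH^*_T(\mathrm{Gr}(k;n))\big)[x]$ be the quantum multiplication by the Chern polynomial of the tautological bundle $\mathcal{S}_k$. Then $$t(x_1)\cdots t(x_{n-k})=\sum_{w\in S^{k,n}}\mathfrak{S}_w(X_1^q,\ldots,X^q_k|y)\;\mathfrak{S}_{w^*}(x_1,\ldots,x_{n-k}|-y),$$ where $x_1,\ldots,x_{n-k}$ are commuting indeterminates and $w^*=w\cdot(12\ldots n)^k\in S^{n-k,n}$.
   Context: Fix $n\ge2$. Let $R=\mathbb{Z}[y_1,\ldots,y_n]$, and $y_j:=0$ for $j>n$. $S^{k,n}\subset S_n$ is the set of Grassmannian permutations $w=[w_1\ldots w_n]$ (one-line notation), i.e. $w_1<\cdots<w_k$ and $w_{k+1}<\cdots<w_n$; they are in bijection with partitions $\lambda(w)=(\lambda_1,\ldots,\lambda_k)$ inside the $k\times(n-k)$ rectangle via $w_j=\lambda_{k+1-j}+j$. For $w\in S^{k,n}$, $w^*=w\cdot(12\ldots n)^k=[w_{k+1}\ldots w_nw_1\ldots w_k]\in S^{n-k,n}$ is again Grassmannian. Put $(x|y)^m=\prod_{i=1}^m(x-y_i)$. The factorial Schur polynomial is $s_\lambda(\xi_1,\ldots,\xi_k|y)=\det\big((\xi_j|y)^{\lambda_i+k-i}\big)_{1\le i,j\le k}/\prod_{i<j}(\xi_i-\xi_j)$, and $h_r=s_{(r)}(\xi_1,\ldots,\xi_k|y)$. For $w\in S^{k,n}$ the double Schubert polynomial is $\mathfrak{S}_w(\xi_1,\ldots,\xi_k|y)=s_{\lambda(w)}(\xi_1,\ldots,\xi_k|y)$;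 $-y$ means that every $y_i$ is replaced by $-y_i$. The equivariant quantum cohomology ring is $$qH_T^*(\mathrm{Gr}(k;n))=R[q^{\pm1}][\xi_1,\ldots,\xi_k]^{S_k}/\langle h_{n-k+1},\ldots,h_{n-1},h_n+(-1)^kq\rangle ,$$ with basis over $R[q^{\pm1}]$ given by the Schubert classes $\sigma_w$ = class of $s_{\lambda(w)}(\xi_1,\ldots,\xi_k|y)$. The $r$-th Chern class $c_r(\mathcal{S}_k)$ is the class of the elementary symmetric polynomial $e_r(\xi_1,\ldots,\xi_k)$, and $t(x)$ is multiplication in this ring by $\sum_{r=0}^kx^{k-r}c_r(\mathcal{S}_k)$. $V=R^n$ has standard basis $v_1,\ldots,v_n$. The module $\bigwedge^kV\otimes_RR[q^{\pm1}]$ is identified with $qH_T^*(\mathrm{Gr}(k;n))$ via $v_{w_1}\wedge\cdots\wedge v_{w_k}\mapsto\sigma_w$. The quantised Chern root is the matrix $$X^q=(-1)^{k-1}q\,E_{1,n}+\sum_{i=1}^{n-1}E_{i+1,i}+\sum_{i=1}^ny_iE_{ii},\qquad E_{ij}v_j=v_i,$$ satisfying $\prod_{j=1}^n(X^q-y_j)=(-1)^{k-1}q$. $X_i^q$ acts on $V^{\otimes k}\otimes_RR[q^{\pm1}]$ as $X^q$ in the $i$-th tensor factor and as the identity elsewhere; symmetric polynomials in $X_1^q,\ldots,X_k^q$ descend to $\bigwedge^kV\otimes_RR[q^{\pm1}]$ and thus act on $qH^*_T(\mathrm{Gr}(k;n))$. *)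

(* Defs.v *)
From HB Require Import structures.
From mathcomp Require Import all_boot all_order all_fingroup all_algebra all_field.
From mathcomp Require Import boolp classical_sets.
From mathcomp Require Import mpoly zify.

Set Implicit Arguments.
Unset Strict Implicit.
Unset Printing Implicit Defensive.

Import GRing.Theory.
Local Open Scope ring_scope.

(* ------------------------------------------------------------------------ *)
(* The ring R[q, q^-1], as the subring of Frac(R[q]) of the fractions whose  *)
(* denominator is a power of q.                                              *)

Section Laurent.
Variable R : idomainType.
Local Notation qF := (tofrac ('X : {poly R})).

Definition laurent_pred : pred {fraction {poly R}} :=
  fun x => `[< exists (m : nat) (p : {poly R}), x * qF ^+ m = tofrac p >].

Lemma laurent_subring : subring_closed laurent_pred.
Proof.
split.
- by apply/asboolP; exists 0%N, 1; rewrite expr0 mulr1 rmorph1.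
- move=> x y /asboolP[m [p hp]] /asboolP[m' [p' hp']].
  apply/asboolP; exists (m + m')%N, (p * 'X^m' - p' * 'X^m).
  rewrite rmorphB !rmorphM !rmorphXn /= -hp -hp' mulrBl exprD mulrA.
  by rewrite -!mulrA [qF ^+ m * _]mulrC.
- move=> x y /asboolP[m [p hp]] /asboolP[m' [p' hp']].
  apply/asboolP; exists (m + m')%N, (p * p').
  by rewrite rmorphM /= -hp -hp' exprD mulrACA.
Qed.

HB.instance Definition _ :=
  GRing.isSubringClosed.Build {fraction {poly R}} laurent_pred laurent_subring.

Record laurent := Laurent { laurent_val : {fraction {poly R}};
                            _ : laurent_val \in laurent_pred }.

HB.instance Definition _ := [isSub for laurent_val].
HB.instance Definition _ := [Choice of laurent by <:].
HB.instance Definition _ := [SubChoice_isSubComNzRing of laurent by <:].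

Lemma laurent_polyP (p : {poly R}) : tofrac p \in laurent_pred.
Proof. by apply/asboolP; exists 0%N, p; rewrite expr0 mulr1. Qed.

Definition laurent_poly (p : {poly R}) : laurent := Laurent (laurent_polyP p).
Definition laurentC (a : R) : laurent := laurent_poly a%:P.
Definition laurentX : laurent := laurent_poly 'X.

Lemma laurentX_unitP : qF^-1 \in laurent_pred.
Proof.
apply/asboolP; exists 1%N, 1; rewrite expr1 mulVf ?rmorph1 //.
by rewrite tofrac_eq0 polyX_eq0.
Qed.

Lemma laurentX_unit : laurentX * Laurent laurentX_unitP = 1.
Proof.
apply: val_inj; rewrite rmorphM rmorph1 /= mulfV //.
by rewrite tofrac_eq0 polyX_eq0.
Qed.

(* A morphism R[q] -> K making q invertible extends to R[q, q^-1]. *)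
Section Lift.
Variables (K : fieldType) (f : {rmorphism {poly R} -> K}).
Hypothesis fX : f 'X != 0.

Lemma laurentP (x : laurent) :
  exists mp : nat * {poly R}, laurent_val x * qF ^+ mp.1 = tofrac mp.2.
Proof. by case: x => x /= /asboolP[m [p h]]; exists (m, p). Qed.

Definition laurent_lift (x : laurent) : K :=
  let mp := sval (cid (laurentP x)) in f mp.2 / f 'X ^+ mp.1.

Lemma laurent_liftE (x : laurent) m p :
  laurent_val x * qF ^+ m = tofrac p -> laurent_lift x = f p / f 'X ^+ m.
Proof.
move=> h; rewrite /laurent_lift; case: cid => -[m' p'] /= h'.
have: p' * 'X^m = p * 'X^m'.
  apply/eqP; rewrite -tofrac_eq !rmorphM !rmorphXn /= -h -h'.
  by rewrite -!mulrA [qF ^+ m * _]mulrC.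
move=> /(congr1 f); rewrite !rmorphM !rmorphXn /= => e.
by apply/eqP; rewrite eqr_div ?expf_neq0 // e.
Qed.

Lemma laurent_lift_poly p : laurent_lift (laurent_poly p) = f p.
Proof. by rewrite (@laurent_liftE _ 0 p) ?expr0 ?mulr1 ?divr1. Qed.

Lemma laurent_lift_zmod : zmod_morphism laurent_lift.
Proof.
move=> x y; have [[m p] /= hp] := laurentP x; have [[m' p'] /= hp'] := laurentP y.
rewrite (laurent_liftE hp) (laurent_liftE hp').
rewrite (@laurent_liftE _ (m + m') (p * 'X^m' - p' * 'X^m)); last first.
  rewrite !rmorphB !rmorphM !rmorphXn /= -hp -hp' mulrBl exprD mulrA.
  by rewrite -!mulrA [qF ^+ m * _]mulrC.
rewrite rmorphB !rmorphM !rmorphXn /= exprD -[in RHS](mulNr (f p')) addf_div ?expf_neq0 //.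
by rewrite mulNr.
Qed.

Lemma laurent_lift_monoid : monoid_morphism laurent_lift.
Proof.
split; first by rewrite (@laurent_liftE _ 0 1) ?expr0 ?mulr1 ?rmorph1 ?divr1.
move=> x y; have [[m p] /= hp] := laurentP x; have [[m' p'] /= hp'] := laurentP y.
rewrite (laurent_liftE hp) (laurent_liftE hp').
rewrite (@laurent_liftE _ (m + m') (p * p')); last first.
  by rewrite !rmorphM /= -hp -hp' exprD mulrACA.
by rewrite rmorphM exprD mulf_div.
Qed.

End Lift.
End Laurent.

(* L[xi_1, ..., xi_k]^(S_k) *)

Section SymPoly.
Variables (L : comNzRingType) (k : nat).

Record sympoly := SymPoly { sym_val :> {mpoly L[k]};
                            _ : sym_val \in @symmetric_pred k L }.

HB.instance Definition _ := [isSub for sym_val].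
HB.instance Definition _ := [Choice of sympoly by <:].
HB.instance Definition _ := [SubChoice_isSubComNzRing of sympoly by <:].
HB.instance Definition _ := [SubZmodule_isSubLmodule of sympoly by <:].
HB.instance Definition _ := [SubNzRing_SubLmodule_isSubLalgebra of sympoly by <:].

Definition sym_elem (r : nat) : sympoly := SymPoly (mesym_sym k L r).

End SymPoly.

Lemma bialternant_quot (A : comNzRingType) (k : nat) (x : 'I_k -> A)
    (a : nat -> A) (e : 'I_k -> nat) :
  exists2 C : 'M[A]_k,
    \det (\matrix_(i < k, j < k) \prod_(l < e i) (x j - a l))
      = \det C * \det (Vandermonde k (\row_j x j))
    & forall (f : {rmorphism A -> A}) (s : 'S_k),
        (forall i, f (x i) = x (s i)) -> (forall l, f (a l) = a l) ->
        f (\det C) = \det C.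
Proof.
pose M : {poly A} := \prod_(l < k) ('X - (x l)%:P).
pose F m : {poly A} := \prod_(l < m) ('X - (a l)%:P).
pose r m := Pdiv.CommonRing.rmodp (F m) M.
have M_monic : M \is monic by exact: monic_prod_XsubC.
have size_M : size M = k.+1.
  by rewrite /M size_prod_XsubC /index_enum -enumT size_enum_ord.
have size_r m : (size (r m) <= k)%N.
  by rewrite -ltnS -size_M Pdiv.CommonRing.ltn_rmodpN0 ?monic_neq0.
have r_eval m (j : 'I_k) :
    \prod_(l < m) (x j - a l) = \sum_(c < k) (r m)`_c * x j ^+ c.
  rewrite -horner_coef_wide //.
  transitivity (F m).[x j].
    by rewrite /F horner_prod; apply: eq_bigr => i _; rewrite hornerXsubC.
  rewrite [F m](Pdiv.RingMonic.rdivp_eq M_monic) hornerD hornerM.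
  have -> : M.[x j] = 0.
    by rewrite /M horner_prod (bigD1 j) //= hornerXsubC subrr mul0r.
  by rewrite mulr0 add0r.
exists (\matrix_(i < k, c < k) (r (e i))`_c).
  rewrite -det_mulmx; congr (\det _); apply/matrixP => i j.
  by rewrite !mxE r_eval; apply: eq_bigr => c _; rewrite !mxE.
move=> f s fx fa.
have mapM : map_poly f M = M.
  rewrite /M rmorph_prod /= [RHS](reindex_inj (@perm_inj _ s)) /=.
  by apply: eq_bigr => i _; rewrite rmorphB /= map_polyX map_polyC /= fx.
have mapF m : map_poly f (F m) = F m.
  rewrite /F rmorph_prod /=; apply: eq_bigr => i _.
  by rewrite rmorphB /= map_polyX map_polyC /= fa.
have map_r m : map_poly f (r m) = r m.
  have szr : (size (map_poly f (r m)) < size M)%N.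
    by rewrite size_M ltnS (leq_trans (size_poly _ _)).
  have := congr1 (map_poly f) (Pdiv.RingMonic.rdivp_eq M_monic (F m)).
  rewrite mapF rmorphD rmorphM /= mapM => E; rewrite [in RHS]/r E.
  by rewrite Pdiv.RingMonic.rmodp_addl_mul_small.
rewrite -det_map_mx; congr (\det _).
by apply/matrixP => i c; rewrite !mxE -coef_map map_r.
Qed.

Lemma vandermonde_prod (A : comNzRingType) (k : nat) (x : 'I_k -> A) :
  \det (\matrix_(i < k, j < k) x j ^+ (k - i.+1))
    = \prod_(i < k) \prod_(j < k | (i < j)%N) (x i - x j).
Proof.
pose rv : 'S_k := perm (@rev_ord_inj k).
pose V := Vandermonde k (\row_j x (rev_ord j)).
have -> : \matrix_(i < k, j < k) x j ^+ (k - i.+1) = row_perm rv (col_perm rv V).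
  by apply/matrixP => i j; rewrite !mxE !permE rev_ordK.
rewrite row_permE col_permE !det_mulmx !det_perm odd_permV mulrCA.
rewrite -signr_addb addbb mulr1 det_Vandermonde.
rewrite pair_big_dep [RHS]pair_big_dep /=.
rewrite (reindex_inj (h := fun p : 'I_k * 'I_k => (rev_ord p.2, rev_ord p.1))) /=.
  apply: eq_big => [[i j]|[i j] _] /=; last by rewrite !mxE !rev_ordK.
  by rewrite ltn_sub2lE // ltnS.
move=> [i j] [i' j'] /= E.
by move: (congr1 fst E) (congr1 snd E) => /= /rev_ord_inj -> /rev_ord_inj ->.
Qed.

(* ------------------------------------------------------------------------ *)
(* Parameters and partitions are functions on nat, indexed from 0: y_i and   *)
(* lambda_i (i >= 1) are [y i.-1] and [lam i.-1].                            *)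

Section FactorialSchur.
Variables (L : comNzRingType) (y : nat -> L) (k : nat).

(* (x|y)^m in the variable x = 'X_j *)
Definition facpow (j : 'I_k) (m : nat) : {mpoly L[k]} :=
  \prod_(i < m) ('X_j - (y i)%:MP).

Definition bialt (lam : nat -> nat) : {mpoly L[k]} :=
  \det (\matrix_(i < k, j < k) facpow j (lam i + (k - i.+1))).

Definition vdm : {mpoly L[k]} :=
  \prod_(i < k) \prod_(j < k | (i < j)%N) ('X_i - 'X_j).

Lemma fschur_exists (lam : nat -> nat) :
  exists p : sympoly L k, sym_val p * vdm = bialt lam.
Proof.
have [C defC symC] := bialternant_quot (fun j : 'I_k => 'X_j : {mpoly L[k]})
  (fun i => (y i)%:MP) (fun i : 'I_k => lam i + (k - i.+1))%N.
pose e : L := \prod_(i < k) \prod_(j < k | (i < j)%N) (-1).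
have eC : e *: \det C \in @symmetric_pred k L.
  apply/issymP => s; rewrite msymZ; congr (_ *: _).
  apply: (symC (msym s) s) => [i|l].
    by rewrite /= /msym mmapX mmap1U.
  by rewrite /= /msym mmapC.
exists (SymPoly eC) => /=.
rewrite /bialt /facpow defC -scalerAl scalerAr; congr (_ * _).
rewrite det_Vandermonde /vdm -mul_mpolyC rmorph_prod -big_split /=.
apply: eq_bigr => i _; rewrite rmorph_prod -big_split /=.
by apply: eq_bigr => j _; rewrite rmorphN1 !mxE mulN1r opprB.
Qed.

(* [vdm] is regular, so that the quotient is unique. *)
Definition fschur (lam : nat -> nat) : sympoly L k := sval (cid (fschur_exists lam)).

Lemma fschurP lam : sym_val (fschur lam) * vdm = bialt lam.
Proof. by rewrite /fschur; case: cid. Qed.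

(* h_r, the factorial Schur polynomial of the one-row partition (r) *)
Definition fhom (r : nat) : sympoly L k := fschur (fun i => if i is 0 then r else 0)%N.

End FactorialSchur.

(* ------------------------------------------------------------------------ *)
(* One-line notations are 0-based: the entry of index i in [oneline w] is    *)
(* w_(i+1) - 1.                                                              *)

Section Grassmannian.
Variable n : nat.

Definition oneline (w : 'S_n) : seq nat := [seq val (w i) | i <- enum 'I_n].

Definition grassmannian (k : nat) (w : 'S_n) : bool :=
  sorted ltn (take k (oneline w)) && sorted ltn (drop k (oneline w)).

(* w_j = lambda_(k+1-j) + j, solved for lambda_(i+1) *)
Definition grass_part (k : nat) (w : 'S_n) (i : nat) : nat :=
  if (i < k)%N then (nth 0 (oneline w) (k - i.+1) - (k - i.+1))%N else 0%N.

(* the cycle (1 2 ... n) *)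
Definition long_cycle : 'S_n := perm (can_inj (@ordSK n)).

(* w o (1 2 ... n)^k: products in {perm _} are read from left to right. *)
Definition wstar (k : nat) (w : 'S_n) : 'S_n := (long_cycle ^+ k * w)%g.

Lemma oneline_wstar k w : (k <= n)%N -> oneline (wstar k w) = rot k (oneline w).
Proof.
move=> kn; have szl u : size (oneline u) = n by rewrite size_map size_enum_ord.
have nthl u (i : 'I_n) : nth 0%N (oneline u) i = u i.
  by rewrite (nth_map i) ?size_enum_ord // nth_ord_enum.
have cycE m (i : 'I_n) : (long_cycle ^+ m)%g i = ((i + m) %% n)%N :> nat.
  elim: m => [|m IH]; first by rewrite expg0 perm1 addn0 modn_small.
  by rewrite expgSr permM permE /= IH -addn1 modnDml addn1 addnS.
apply: (@eq_from_nth _ 0%N); first by rewrite size_rot !szl.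
move=> j; rewrite szl => jn; rewrite (nthl _ (Ordinal jn)) permM.
set z := ((long_cycle ^+ k)%g _).
have -> : val (w z) = nth 0%N (oneline w) z by rewrite nthl.
rewrite cycE /= /rot nth_cat size_drop szl nth_drop.
case: ltnP => h; first by rewrite modn_small addnC // -ltn_subRL.
have jE : (j + k = j - (n - k) + n)%N by rewrite -{2}(subnK kn) addnA subnK.
have lt_k : (j - (n - k) < k)%N by rewrite ltn_subLR // subnK.
by rewrite nth_take // jE modnDr modn_small // (leq_trans lt_k).
Qed.

End Grassmannian.

Definition schubert (L : comNzRingType) (y : nat -> L) (n k : nat) (w : 'S_n) :
  sympoly L k := fschur y k (grass_part k w).

(* ------------------------------------------------------------------------ *)
(* The L-algebra End_L(M) of a nonzero L-module M, so that it can be used as *)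
(* a ring of coefficients of polynomials; the product is the composition.    *)

Section LinearMaps.
Variables (L : comNzRingType) (M N : lmodType L).

Definition mklin (f : M -> N) (fL : linear f) : {linear M -> N} :=
  HB.pack f (GRing.isLinear.Build L M N *:%R f fL).

Lemma mklinE f fL x : @mklin f fL x = f x. Proof. by []. Qed.

Lemma linear_ext (f g : {linear M -> N}) : f =1 g -> f = g.
Proof.
case: f g => [f [[F1] [F2]]] [g [[G1] [G2]]] /= /funext e.
by subst g; rewrite (Prop_irrelevance F1 G1) (Prop_irrelevance F2 G2).
Qed.

End LinearMaps.

Section LinearEnd.
Variables (L : comNzRingType) (M : lmodType L) (x0 : M).

Definition lend (nz : x0 != 0) : Type := {linear M -> M}.

Variable nz : x0 != 0.
Local Notation E := (lend nz).

HB.instance Definition _ := gen_eqMixin E.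
HB.instance Definition _ := gen_choiceMixin E.

Implicit Types (f g h : E) (a b : L).

Let lin0 : linear (fun _ : M => 0 : M).
Proof. by move=> a x y; rewrite scaler0 addr0. Qed.
Let lin1 : linear (fun x : M => x).
Proof. by []. Qed.
Let linN f : linear (fun x => - f x).
Proof. by move=> a x y; rewrite linearP opprD scalerN. Qed.
Let linD f g : linear (fun x => f x + g x).
Proof. by move=> a x y; rewrite !linearP scalerDr addrACA. Qed.
Let linM f g : linear (fun x => f (g x)).
Proof. by move=> a x y; rewrite !linearP. Qed.
Let linZ a f : linear (fun x => a *: f x).
Proof. by move=> b x y; rewrite linearP scalerDr !scalerA mulrC. Qed.

Definition lend0 : E := mklin lin0.
Definition lend1 : E := mklin lin1.
Definition lendN f : E := mklin (linN f).
Definition lendD f g : E := mklin (linD f g).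
Definition lendM f g : E := mklin (linM f g).
Definition lendZ a f : E := mklin (linZ a f).

Let addA : associative lendD.
Proof. by move=> f g h; apply: linear_ext => x; rewrite /= addrA. Qed.
Let addC : commutative lendD.
Proof. by move=> f g; apply: linear_ext => x; rewrite /= addrC. Qed.
Let add0 : left_id lend0 lendD.
Proof. by move=> f; apply: linear_ext => x; rewrite /= add0r. Qed.
Let addN : left_inverse lend0 lendN lendD.
Proof. by move=> f; apply: linear_ext => x; rewrite /= addNr. Qed.
HB.instance Definition _ := GRing.isZmodule.Build E addA addC add0 addN.

Let mulA : associative lendM.
Proof. by move=> f g h; apply: linear_ext. Qed.
Let mul1 : left_id lend1 lendM.
Proof. by move=> f; apply: linear_ext. Qed.
Let mulr1 : right_id lend1 lendM.
Proof. by move=> f; apply: linear_ext. Qed.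
Let mulDl : left_distributive lendM +%R.
Proof. by move=> f g h; apply: linear_ext. Qed.
Let mulDr : right_distributive lendM +%R.
Proof. by move=> f g h; apply: linear_ext => x; rewrite /= linearD. Qed.
Let oner_neq0 : lend1 != 0.
Proof.
apply: contra nz => /eqP /(congr1 (fun f : {linear M -> M} => f x0)) /= ->.
exact: eqxx.
Qed.
HB.instance Definition _ :=
  GRing.Zmodule_isNzRing.Build E mulA mul1 mulr1 mulDl mulDr oner_neq0.

Let scaleA a b f : lendZ a (lendZ b f) = lendZ (a * b) f.
Proof. by apply: linear_ext => x; rewrite /= scalerA. Qed.
Let scale1 : left_id 1 lendZ.
Proof. by move=> f; apply: linear_ext => x; rewrite /= scale1r. Qed.
Let scaleDr : right_distributive lendZ +%R.
Proof. by move=> a f g; apply: linear_ext => x; rewrite /= scalerDr. Qed.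
Let scaleDl f : {morph lendZ^~ f : a b / a + b}.
Proof. by move=> a b; apply: linear_ext => x; rewrite /= scalerDl. Qed.
HB.instance Definition _ :=
  GRing.Zmodule_isLmodule.Build L E scaleA scale1 scaleDr scaleDl.

Let scaleAl a f g : a *: (f * g) = a *: f * g.
Proof. by apply: linear_ext. Qed.
HB.instance Definition _ := GRing.Lmodule_isLalgebra.Build L E scaleAl.

Let scaleAr a f g : a *: (f * g) = f * (a *: g).
Proof. by apply: linear_ext => x; rewrite /= linearZ. Qed.
HB.instance Definition _ := GRing.Lalgebra_isAlgebra.Build L E scaleAr.

Lemma lend_mulE f g x : (f * g) x = f (g x). Proof. by []. Qed.
Lemma lend_scaleE a f x : (a *: f) x = a *: f x. Proof. by []. Qed.

End LinearEnd.

(* ------------------------------------------------------------------------ *)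
(* R = Z[y_1, ..., y_n] and R[q, q^-1]; [ypar] is zero from index n on. *)
Definition coefring (n : nat) : idomainType := {mpoly int[n]}.
Definition qring (n : nat) : comNzRingType := laurent (coefring n).

Definition qpar (n : nat) : qring n := laurentX (coefring n).
Definition ypar (n : nat) (i : nat) : qring n :=
  if insub i is Some j then laurentC ('X_j : coefring n) else 0.

Section QuantumCohomology.
Variables (n k : nat) (hk : (1 <= k <= n - 1)%N).
Local Notation L := (qring n).
Local Notation y := (@ypar n).

Lemma k_le_n : (k <= n)%N.
Proof. by case/andP: hk => _ /leq_trans; apply; exact: leq_subr. Qed.

Lemma gr_n_gt0 : (0 < n)%N.
Proof. by case/andP: hk => k0 _; exact: leq_trans k_le_n. Qed.

(* h_(n-k+1), ..., h_(n-1), h_n + (-1)^k q *)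
Definition qgen (i : 'I_k) : sympoly L k :=
  fhom y k (n - k + i.+1) +
  (if i.+1 == k then ((-1) ^+ k * qpar n) *: 1 else 0).

Definition qideal (_ : (1 <= k <= n - 1)%N) : pred (sympoly L k) :=
  fun p => `[< exists c : 'I_k -> sympoly L k, p = \sum_(i < k) c i * qgen i >].

Section Specialization.
Variable w : algC.
Hypothesis wP : n.-primitive_root w.

Let f0 : coefring n -> algC := mmap (intr : int -> algC) (fun=> 0).
Let f0_zmod : zmod_morphism f0.
Proof. exact: (raddfB (mmap (intr : int -> algC) (fun=> 0))). Qed.
Let f0_monoid : monoid_morphism f0.
Proof.
split; first exact: (rmorph1 (mmap (intr : int -> algC) (fun=> 0))).
exact: (rmorphM (mmap (intr : int -> algC) (fun=> 0))).
Qed.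
HB.instance Definition _ := GRing.isZmodMorphism.Build (coefring n) algC f0 f0_zmod.
HB.instance Definition _ := GRing.isMonoidMorphism.Build (coefring n) algC f0 f0_monoid.

Let f1 : {rmorphism {poly coefring n} -> algC} :=
  horner_eval (- (-1) ^+ k : algC) \o map_poly f0.

Let f1X : f1 'X = - (-1) ^+ k.
Proof. by rewrite /f1 /= /horner_eval map_polyX hornerX. Qed.
Let f1X_neq0 : f1 'X != 0.
Proof. by rewrite f1X oppr_eq0 signr_eq0. Qed.

Let f2 : L -> algC := laurent_lift f1.
Let f2_zmod : zmod_morphism f2. Proof. exact: laurent_lift_zmod f1X_neq0. Qed.
Let f2_monoid : monoid_morphism f2. Proof. exact: laurent_lift_monoid f1X_neq0. Qed.
HB.instance Definition _ := GRing.isZmodMorphism.Build L algC f2 f2_zmod.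
HB.instance Definition _ := GRing.isMonoidMorphism.Build L algC f2 f2_monoid.

Let f2y i : f2 (y i) = 0.
Proof.
rewrite /ypar; case: insubP => [j _ _|_]; last exact: rmorph0.
rewrite /f2 (laurent_lift_poly f1X_neq0) /f1 /= /horner_eval map_polyC hornerC.
by rewrite -[LHS]/(f0 'X_j) /f0 mmapX mmap1U.
Qed.
Let f2q : f2 (qpar n) = - (-1) ^+ k.
Proof. by rewrite /f2 (laurent_lift_poly f1X_neq0) f1X. Qed.

Let ev : {rmorphism {mpoly L[k]} -> algC} := mmap f2 (fun i : 'I_k => w ^+ i).

Let ev_facpow (j : 'I_k) m : ev (facpow y j m) = (w ^+ j) ^+ m.
Proof.
rewrite /facpow rmorph_prod /= (eq_bigr (fun=> w ^+ j)) => [|i _].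
  by rewrite prodr_const card_ord.
by rewrite rmorphB /= mmapC /= f2y subr0 mmapX mmap1U.
Qed.

Let ev_bialt lam : ev (bialt y k lam) =
  \det (\matrix_(i < k, j < k) (w ^+ j) ^+ (lam i + (k - i.+1))).
Proof.
rewrite -det_map_mx; congr (\det _).
by apply/matrixP => i j; rewrite !mxE ev_facpow.
Qed.

Let ev_vdm : ev (vdm L k) = \prod_(i < k) \prod_(j < k | (i < j)%N) (w ^+ i - w ^+ j).
Proof.
rewrite rmorph_prod /=; apply: eq_bigr => i _.
rewrite rmorph_prod /=; apply: eq_bigr => j _.
by rewrite rmorphB /= !mmapX !mmap1U.
Qed.

Let ev_vdm_neq0 : ev (vdm L k) != 0.
Proof.
rewrite ev_vdm; apply/prodf_neq0 => i _; apply/prodf_neq0 => j ij.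
rewrite subr_eq0 (eq_prim_root_expr wP) !modn_small ?(leq_trans _ k_le_n) //.
by rewrite neq_ltn ij.
Qed.

Let ev_gen (i : 'I_k) : ev (qgen i) = 0.
Proof.
have wn m : w ^+ (n + m) = w ^+ m by rewrite exprD (prim_expr_order wP) mul1r.
have row0 (j : 'I_k) : (w ^+ j) ^+ ((n - k + i.+1) + (k - 1)) = (w ^+ j) ^+ i.
  have -> : (n - k + i.+1 + (k - 1) = n + i)%N.
    by have := k_le_n; have := ltn_ord i; lia.
  by rewrite -!exprM mulnDr exprD mulnC exprM (prim_expr_order wP) expr1n mul1r.
have evh : ev (fhom y k (n - k + i.+1)) * ev (vdm L k)
    = \det (\matrix_(i' < k, j < k)
        (w ^+ j) ^+ (if val i' is 0 then val i else k - i'.+1)).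
  rewrite -rmorphM fschurP ev_bialt; congr (\det _).
  apply/matrixP => -[[|i'] hi'] j; rewrite !mxE /=; last by rewrite add0n.
  exact: row0.
have {}evh : ev (fhom y k (n - k + i.+1)) = (i.+1 == k)%:R.
  apply: (mulIf ev_vdm_neq0); rewrite evh; case: eqP => ik.
    rewrite mul1r ev_vdm -(vandermonde_prod (fun j : 'I_k => w ^+ j)).
    congr (\det _); apply/matrixP => -[[|i'] hi'] j; rewrite !mxE //=.
    by congr (_ ^+ _); move: ik; lia.
  rewrite mul0r; have ik' : (i.+1 < k)%N by rewrite ltn_neqAle ltn_ord andbT; apply/eqP.
  have k0 : (0 < k)%N by apply: leq_trans ik'.
  have hi : (k - i.+1 < k)%N by lia.
  pose z := Ordinal k0; pose z' : 'I_k := Ordinal hi.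
  apply: (@determinant_alternate _ _ _ z z') => [|j].
    by rewrite -val_eqE /=; lia.
  rewrite !mxE /=; congr (_ ^+ _).
  by case E: (k - i.+1)%N => [|d]; move: E; lia.
rewrite /qgen [sym_val _]/= rmorphD /= evh; case: eqP => _.
  have valZ c : sym_val (c *: (1 : sympoly L k)) = c *: (1 : {mpoly L[k]}) by [].
  rewrite valZ mmapZ [mmap _ _ 1]rmorph1 mulr1 rmorphM rmorphXn rmorphN1 /= f2q.
  by rewrite mulrN -expr2 sqrr_sign subrr.
have -> : sym_val (0 : sympoly L k) = 0 by [].
by rewrite [mmap _ _ 0]rmorph0 addr0.
Qed.

Lemma qideal_proper_spec : 1 \notin qideal hk.
Proof.
apply/negP => /asboolP[c e].
have e1 : (1 : {mpoly L[k]}) = \sum_(i < k) sym_val (c i) * sym_val (qgen i).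
  transitivity (sym_val (1 : sympoly L k)); first by [].
  rewrite e; exact: (rmorph_sum val).
have /eqP := congr1 ev e1.
rewrite rmorph1 rmorph_sum big1 ?oner_eq0 // => i _.
by rewrite rmorphM /= ev_gen mulr0.
Qed.
End Specialization.

Lemma qideal_proper : 1 \notin qideal hk.
Proof. by have [w wP] := C_prim_root_exists gr_n_gt0; apply: qideal_proper_spec wP. Qed.

Lemma qideal_closed : idealr_closed (qideal hk).
Proof.
split; last move=> a p p' /asboolP[c ->] /asboolP[c' ->].
- apply/asboolP; exists (fun=> 0).
  by rewrite big1 // => i _; rewrite mul0r.
- exact: qideal_proper.
- apply/asboolP; exists (fun i => a * c i + c' i).
  rewrite mulr_sumr -big_split /=.
  by apply: eq_bigr => i _; rewrite mulrDl mulrA.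
Qed.

HB.instance Definition _ := isIdealr.Build (sympoly L k) (qideal hk) qideal_closed.

Definition qidealr : idealr (sympoly L k) := Idealr.clone _ (qideal hk) _.

(* qH_T^*(Gr(k; n)) *)
Definition qH : Type := {ideal_quot qidealr}.
HB.instance Definition _ := GRing.ComNzRing.on qH.

Definition qclass (p : sympoly L k) : qH := \pi_({ideal_quot qidealr})%qT p.

Lemma qclass_zmod : zmod_morphism qclass.
Proof. exact: pi_is_zmod_morphism. Qed.
Lemma qclass_monoid : monoid_morphism qclass.
Proof. exact: pi_is_monoid_morphism. Qed.
HB.instance Definition _ :=
  GRing.isZmodMorphism.Build (sympoly L k) qH qclass qclass_zmod.
HB.instance Definition _ :=
  GRing.isMonoidMorphism.Build (sympoly L k) qH qclass qclass_monoid.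

Definition qH_scale (a : L) (x : qH) : qH := qclass a%:A * x.

Let scaleA a b x : qH_scale a (qH_scale b x) = qH_scale (a * b) x.
Proof. by rewrite /qH_scale mulrA -rmorphM -in_algE -rmorphM. Qed.
Let scale1 : left_id 1 qH_scale.
Proof. by move=> x; rewrite /qH_scale scale1r rmorph1 mul1r. Qed.
Let scaleDr : right_distributive qH_scale +%R.
Proof. by move=> a x x'; rewrite /qH_scale mulrDr. Qed.
Let scaleDl x : {morph qH_scale^~ x : a b / a + b}.
Proof. by move=> a b; rewrite /qH_scale scalerDl rmorphD mulrDl. Qed.
HB.instance Definition _ :=
  GRing.Zmodule_isLmodule.Build L qH scaleA scale1 scaleDr scaleDl.

Let scaleAl (a : L) (x x' : qH) : a *: (x * x') = a *: x * x'.
Proof. exact: mulrA. Qed.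
HB.instance Definition _ := GRing.Lmodule_isLalgebra.Build L qH scaleAl.
HB.instance Definition _ := GRing.Lalgebra_isComAlgebra.Build L qH.

Lemma qclass_scale a p : qclass (a *: p) = a *: qclass p.
Proof. by rewrite -[RHS]/(qclass a%:A * qclass p) -rmorphM mulr_algl. Qed.

Definition qEnd : Type := lend (oner_neq0 qH).
HB.instance Definition _ := GRing.Algebra.on qEnd.

Let qmul_linear (a : qH) : linear (fun x : qH => a * x).
Proof. by move=> b x x'; rewrite mulrDr scalerAr. Qed.
Definition qmul (a : qH) : qEnd := mklin (qmul_linear a).

Definition chern (r : nat) : qH := qclass (sym_elem L k r).

(* t(x), where x = 'X *)
Definition chern_poly : {poly qEnd} :=
  \sum_(r < k.+1) qmul (chern r) *: 'X^(k - r).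

(* t(x_i) as an element of End(qH)[x_1, ..., x_m] *)
Definition chern_at (m : nat) (i : 'I_m) : {mpoly qEnd[m]} :=
  (map_poly (@mpolyC m qEnd) chern_poly).['X_i].

Definition sigma (w : 'S_n) : qH := qclass (schubert y k w).

(* The tensor power V^(tensor k) over L, in coordinates: [t a] is the        *)
(* coefficient in t of v_(a 0) (x) ... (x) v_(a (k-1)).                      *)
Definition multi : finType := {ffun 'I_k -> 'I_n}.
Definition tensor : lmodType L := {ffun multi -> L^o}.

Definition vten (a : multi) : tensor := [ffun b => (a == b)%:R].

Lemma vten_neq0 : vten [ffun=> Ordinal gr_n_gt0] != 0.
Proof.
apply/eqP => /ffunP /(_ [ffun=> Ordinal gr_n_gt0]) /eqP.
by rewrite !ffunE eqxx oner_eq0.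
Qed.

Definition tEnd : Type := lend vten_neq0.
HB.instance Definition _ := GRing.Algebra.on tEnd.

(* [E_ij v_j = v_i] makes the matrix act on column vectors. *)
Definition Xq : 'M[L]_n :=
  \matrix_(i, j) (((-1) ^+ (k - 1) * qpar n) *+ ((val i == 0) && (val j == n - 1))%N
                  + (val i == (val j).+1)%:R + y i *+ (i == j)).

Definition upd (a : multi) (i : 'I_k) (b : 'I_n) : multi :=
  [ffun j => if j == i then b else a j].

Let Xact_linear (i : 'I_k) :
  linear (fun t : tensor =>
    [ffun a : multi => \sum_(b < n) Xq (a i) b * t (upd a i b)] : tensor).
Proof.
move=> c t t'; apply/ffunP => a; rewrite !ffunE scaler_sumr -big_split /=.
apply: eq_bigr => b _; rewrite ffunE mulrDr; congr (_ + _).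
rewrite ffunE; exact: mulrCA.
Qed.

(* X^q_i *)
Definition Xact (i : 'I_k) : tEnd := mklin (Xact_linear i).

(* f(X^q_1, ..., X^q_k) *)
Definition symX (f : sympoly L k) : tEnd :=
  mmap (fun c : L => c%:A) Xact (sym_val f).

(* The exterior power, free on v_(w_1) /\ ... /\ v_(w_k) for w in S^(k,n). *)
Definition grass : finType := {w : 'S_n | grassmannian k w}.
Definition wedge_power : lmodType L := {ffun grass -> L^o}.

Definition vindex (w : 'S_n) : multi := [ffun j : 'I_k => w (widen_ord k_le_n j)].

(* v_(a 0) (x) ... (x) v_(a (k-1)) |-> v_(a 0) /\ ... /\ v_(a (k-1)): the     *)
(* multi-indices with a nonzero w-coordinate are the rearrangements of w,    *)
(* weighted by their signs.                                                  *)
Let wedge_linear :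
  linear (fun t : tensor =>
    [ffun w : grass => \sum_(s : 'S_k)
       (-1) ^+ s * t [ffun j => vindex (val w) (s j)]] : wedge_power).
Proof.
move=> c t t'; apply/ffunP => w; rewrite !ffunE scaler_sumr -big_split /=.
apply: eq_bigr => s _; rewrite ffunE mulrDr; congr (_ + _).
rewrite ffunE; exact: mulrCA.
Qed.
Definition wedge : {linear tensor -> wedge_power} := mklin wedge_linear.

Definition wedge_lift (u : wedge_power) : tensor :=
  \sum_(w : grass) (u w : L) *: vten (vindex (val w)).

(* The map induced by f(X^q_1, ..., X^q_k) on the exterior power: f being    *)
(* symmetric, [symX f] preserves the kernel of [wedge], and any lift will do. *)
Definition symX_wedge (f : sympoly L k) (u : wedge_power) : wedge_power :=
  wedge (symX f (wedge_lift u)).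

(* the identification v_(w_1) /\ ... /\ v_(w_k) |-> sigma_w *)
Definition wedge_to_qH (u : wedge_power) : qH :=
  \sum_(w : grass) (u w : L) *: sigma (val w).

(* The action of f(X^q_1, ..., X^q_k) on qH. The Schubert classes being a    *)
(* basis, [wedge_to_qH] is bijective and A is unique, namely the conjugate   *)
(* of [symX_wedge f] by [wedge_to_qH].                                       *)
Definition symX_qH (f : sympoly L k) : qEnd :=
  xget (0 : qEnd)
    [set A : qEnd | forall u, A (wedge_to_qH u) = wedge_to_qH (symX_wedge f u)].

End QuantumCohomology.

(* Main.v *)
From HB Require Import structures.
Require Import Defs.
From mathcomp Require Import all_boot all_order all_fingroup all_algebra.
From mathcomp Require Import boolp.
From mathcomp Require Import mpoly zify ring.

Set Implicit Arguments.
Unset Strict Implicit.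
Unset Printing Implicit Defensive.

Import GRing.Theory.
Local Open Scope ring_scope.

(** Two independent facts give the theorem.

    The first is that [f(X^q_1, ..., X^q_k)] acts on [qH] as the product with
    the class of [f] ([symX_qHE]).  Identify a tensor with a polynomial in
    [xi_1, ..., xi_k] by sending [v_a] to the product of the factorial powers
    [(xi_i|y)^(a i)].  Since [(x|y)^j x = (x|y)^(j+1) + y_(j+1) (x|y)^j], the
    matrix [X^q_i] becomes the multiplication by [xi_i], except that in the
    image of the last basis vector [(-1)^(k-1) q] takes the place of
    [(xi_i|y)^n].  Antisymmetrizing and dividing by the Vandermonde product
    (the operator [divdiff]) sends [v_(w_1) (x) ... (x) v_(w_k)] to the
    Schubert polynomial of [w], is alternating, and is linear over symmetric
    polynomials.  It therefore remains to see that [(xi_i|y)^n] and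
    [(-1)^(k-1) q] become equal in [qH]: their difference is a combination of
    the generators of the ideal ([facpow_qgen]), by Lagrange interpolation.
    That the Schubert classes span [qH], so that the action on [qH] is
    determined, is then a by-product: their span contains 1 and is stable
    under the multiplication by every class.

    The second is the dual Cauchy identity for factorial Schur polynomials,
    [prod_(b, a) (x_b + xi_a) = sum_w s_w(xi|y) s_{wstar w}(x|-y)]
    ([dual_cauchy]), which holds before passing to the quotient.  The
    determinant of the [(z_j|y)^i], [0 <= i < n], in the [n] unknowns
    [z = (xi, -x)] is a Vandermonde determinant, hence a product of
    differences; expanding it along its first [k] columns gives a sum over the
    Grassmannian permutations, in which the two minors of the term [w] are, up
    to sign, the bialternants of [s_w(xi|y)] and [s_{wstar w}(x|-y)].

    By the theorem on elementary symmetric polynomials the left hand side of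
    this identity is the product of the [t(x_b)], read in the symmetric
    polynomials; applying the ring morphism that sends [f] to the
    multiplication by its class finishes the proof. *)

(** * Determinants of polynomial values *)

Section Determinants.
Variable A : comNzRingType.

(** The matrix factors as a unitriangular matrix, the coefficients of
    the [p i], times the Vandermonde matrix of the [x j]. *)
Lemma det_monic_eval n (p : 'I_n -> {poly A}) (x : 'I_n -> A) :
    (forall i, p i \is monic) -> (forall i, size (p i) = i.+1) ->
  \det (\matrix_(i, j) (p i).[x j])
    = \prod_(i < n) \prod_(j < n | (i < j)%N) (x j - x i).
Proof.
move=> p_monic size_p.
have -> : \matrix_(i, j) (p i).[x j]
    = (\matrix_(i, c) (p i)`_c) *m Vandermonde n (\row_j x j).
  apply/matrixP=> i j; rewrite !mxE (@horner_coef_wide _ n) ?size_p //.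
  by apply: eq_bigr => c _; rewrite !mxE.
rewrite det_mulmx det_Vandermonde det_trig; last first.
  by apply/is_trig_mxP => i j ij; rewrite mxE nth_default ?size_p.
rewrite big1 ?mul1r => [|i _]; last first.
  by rewrite mxE; have /monicP := p_monic i; rewrite /lead_coef size_p.
by apply: eq_bigr => i _; apply: eq_bigr => j _; rewrite !mxE.
Qed.

(** The factorial power [(x|a)^m] as a polynomial in [x], so that a
    factorial bialternant is a case of [det_monic_eval]. *)
Definition facpoly (a : nat -> A) m : {poly A} := \prod_(l < m) ('X - (a l)%:P).

Lemma facpoly_monic a m : facpoly a m \is monic.
Proof. exact: monic_prod_XsubC. Qed.

Lemma size_facpoly a m : size (facpoly a m) = m.+1.
Proof. by rewrite size_prod_XsubC /index_enum -enumT size_enum_ord. Qed.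

Lemma horner_facpoly a m x : (facpoly a m).[x] = \prod_(l < m) (x - a l).
Proof. by rewrite horner_prod; apply: eq_bigr => l _; rewrite hornerXsubC. Qed.

Lemma horner_prod_XsubC_eq0 (I : eqType) (s : seq I) (x : I -> A) i :
  i \in s -> (\prod_(l <- s) ('X - (x l)%:P)).[x i] = 0.
Proof.
by move=> si; rewrite horner_prod (big_rem i si) /= hornerXsubC subrr mul0r.
Qed.

(** Bialternants list their exponents in decreasing order, one-line
    notations of Grassmannian permutations in increasing order; the sign of the
    reversal, which appears here, is carried along and always occurs twice in
    the end. *)
Lemma det_rev_rows n (M : 'M[A]_n) :
  \det (\matrix_(i, j) M (rev_ord i) j) = (-1) ^+ perm (@rev_ord_inj n) * \det M.
Proof.
rewrite -det_perm -det_mulmx -row_permE; congr (\det _).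
by apply/matrixP=> i j; rewrite !mxE permE.
Qed.

End Determinants.

(** * Grassmannian permutations *)

(** An increasing permutation satisfies [i <= h i], and so does its
    inverse. *)
Lemma increasing_perm1 n (h : 'S_n) :
  (forall i j : 'I_n, (i < j)%N -> (h i < h j)%N) -> h = 1%g.
Proof.
have ge_id (g : 'S_n) (g_inc : forall i j : 'I_n, (i < j)%N -> (g i < g j)%N) :
    forall i : 'I_n, (i <= g i)%N.
  move=> [i]; elim: i => [|i IH] // lt_i.
  by apply: leq_ltn_trans (IH (ltnW lt_i)) _; apply: g_inc.
move=> h_inc; apply/permP => i; rewrite perm1; apply: val_inj.
apply/eqP; rewrite eqn_leq [X in _ && X]ge_id // andbT.
rewrite -{2}(permK h i); apply: ge_id => a b ab.
rewrite ltnNge leq_eqVlt; apply/negP => /orP[/eqP/val_inj/perm_inj E|].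
  by rewrite E ltnn in ab.
by move/h_inc; rewrite !permKV ltnNge ltnW.
Qed.

Section GrassmannianPermutations.
Variables n k : nat.
Hypothesis kn : (k <= n)%N.
Implicit Types u w : 'S_n.

Lemma size_oneline w : size (oneline w) = n.
Proof. by rewrite size_map size_enum_ord. Qed.

Lemma nth_oneline w (i : 'I_n) : nth 0%N (oneline w) i = w i.
Proof. by rewrite (nth_map i) ?size_enum_ord // nth_ord_enum. Qed.

Lemma grassmannianP w :
  reflect (forall i j : 'I_n, (i < j)%N -> (j < k)%N || (k <= i)%N ->
             (w i < w j)%N)
          (grassmannian k w).
Proof.
have szt : size (take k (oneline w)) = k by rewrite size_takel ?size_oneline.
have szd : size (drop k (oneline w)) = (n - k)%N by rewrite size_drop size_oneline.
apply: (iffP andP) => [[inc1 inc2] i j ij /orP[jk|ki]|inc].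
- have := sorted_ltn_nth ltn_trans 0%N inc1 i j.
  have ik := ltn_trans ij jk.
  by rewrite !inE szt !nth_take // !nth_oneline; apply.
- have := sorted_ltn_nth ltn_trans 0%N inc2 (i - k)%N (j - k)%N.
  have kj := leq_trans ki (ltnW ij).
  rewrite !inE szd !nth_drop !subnKC // !nth_oneline.
  by apply; have := ltn_ord j; have := ltn_ord i; lia.
- split; apply/(sortedP 0%N) => i.
    rewrite szt => ik; rewrite !nth_take ?(ltnW ik) //.
    have i1n : (i.+1 < n)%N by apply: leq_trans kn.
    have := inc (Ordinal (ltnW i1n)) (Ordinal i1n) (ltnSn _).
    by rewrite /= ik -!nth_oneline; apply.
  rewrite szd => ik; rewrite !nth_drop.
  have i1n : (k + i.+1 < n)%N by lia.
  have i0n : (k + i < n)%N by lia.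
  have := inc (Ordinal i0n) (Ordinal i1n); rewrite -!nth_oneline /=.
  by apply; rewrite ?leq_addr ?orbT // addnS.
Qed.

(** The transition [w * w'^-1] preserves both blocks of positions and is
    increasing on each, hence is increasing. *)
Lemma grassmannian_unique w w' :
    grassmannian k w -> grassmannian k w' ->
    (forall x, ((w^-1)%g x < k)%N = ((w'^-1)%g x < k)%N) ->
  w = w'.
Proof.
move=> /grassmannianP inc /grassmannianP inc' same.
pose h := (w * w'^-1)%g.
have w'h i : w' (h i) = w i by rewrite permM permKV.
have hk i : (h i < k)%N = (i < k)%N by rewrite permM -same permK.
suff h1 : h = 1%g by rewrite -[w](mulgKV w') -/h h1 mul1g.
apply: increasing_perm1 => i j ij.
have [/andP[ik kj]|block] := boolP ((i < k)%N && (k <= j)%N).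
  by apply: (@leq_trans k); [rewrite hk | rewrite leqNgt hk -leqNgt].
have block_ij : (j < k)%N || (k <= i)%N by move: block ij; lia.
rewrite ltnNge leq_eqVlt; apply/negP => /orP[/eqP/val_inj/perm_inj E|lt_h].
  by rewrite E ltnn in ij.
have := inc' _ _ lt_h; rewrite hk [(k <= h j)%N]leqNgt hk -leqNgt !w'h.
have := inc _ _ ij block_ij; move: block ij; lia.
Qed.

Lemma sorted_val_enum (S : {set 'I_n}) : sorted ltn (map val (enum S)).
Proof.
have -> : enum S = filter (mem S) (enum 'I_n) by rewrite enumT.
have := iota_ltn_sorted 0 n; rewrite -val_enum_ord sorted_map => inc_enum.
by rewrite sorted_map; apply: sorted_filter inc_enum => x y z; apply: ltn_trans.
Qed.

End GrassmannianPermutations.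

(** List [S] in increasing order, then its complement in increasing
    order. *)
Lemma grassmannian_exists n (S : {set 'I_n}) :
  exists2 w : 'S_n, grassmannian #|S| w
    & forall i, (w i \in S) = (i < #|S|)%N.
Proof.
pose s := enum S ++ enum (~: S).
have size_s : size s = n by rewrite size_cat -!cardE cardsC card_ord.
have uniq_s : uniq s.
  rewrite cat_uniq !enum_uniq andbT; apply/hasPn => x.
  by rewrite !mem_enum inE.
pose f (i : 'I_n) := nth i s i.
have fE (i j : 'I_n) : f i = nth j s i by apply: set_nth_default; rewrite size_s.
have f_inj : injective f.
  move=> i j; rewrite (fE i j) => /eqP.
  by rewrite nth_uniq ?size_s // => /eqP/val_inj.
exists (perm f_inj); last first.
  move=> i; rewrite permE /f /s nth_cat -cardE; case: ltnP => iS.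
    by rewrite -mem_enum mem_nth // -cardE.
  apply/negbTE; rewrite -in_setC -mem_enum mem_nth //.
  by rewrite -cardE -(ltn_add2l #|S|) subnKC // cardsC card_ord.
apply/grassmannianP => [|i j ij].
  by rewrite -[X in (_ <= X)%N](card_ord n) max_card.
have iS : #|S| = size (enum S) by rewrite cardE.
rewrite !permE (fE i j) /f /s !nth_cat -iS.
have inc T a b : (a < b)%N -> (b < size (enum (T : {set 'I_n})))%N ->
    (nth j (enum T) a < nth j (enum T) b)%N.
  move=> ab bT; have := sorted_ltn_nth ltn_trans 0%N (sorted_val_enum T) a b.
  rewrite !inE size_map bT (ltn_trans ab bT) !(nth_map j) ?(ltn_trans ab bT) //.
  exact.
case/orP=> [jS|Si].
  by rewrite jS (ltn_trans ij jS); apply: inc; rewrite -?iS.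
have Sj := leq_trans Si (ltnW ij).
rewrite (ltnNge i) Si (ltnNge j) Sj /=; apply: inc.
  exact: ltn_sub2r (leq_ltn_trans Si ij) ij.
by rewrite -cardE -(ltn_add2l #|S|) subnKC ?cardsC ?card_ord.
Qed.

(** * Coset decompositions by Grassmannian permutations *)

Section BlockPermutations.
Variables k m : nat.

Definition block_fun (s : 'S_k) (t : 'S_m) (i : 'I_(k + m)) : 'I_(k + m) :=
  match split i with inl a => lshift m (s a) | inr b => rshift k (t b) end.

Lemma block_fun_inj s t : injective (block_fun s t).
Proof.
move=> i j; rewrite /block_fun.
case: (split_ordP i) => a ->; case: (split_ordP j) => b ->.
- by move/lshift_inj/perm_inj->.
- by move/eqP; rewrite eq_lrshift.
- by move/eqP; rewrite eq_rlshift.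
- by move/rshift_inj/perm_inj->.
Qed.

Definition block_perm s t : 'S_(k + m) := perm (@block_fun_inj s t).

Lemma block_permL s t a : block_perm s t (lshift m a) = lshift m (s a).
Proof. by rewrite permE /block_fun (unsplitK (inl a)). Qed.

Lemma block_permR s t b : block_perm s t (rshift k b) = rshift k (t b).
Proof. by rewrite permE /block_fun (unsplitK (inr b)). Qed.

(** The permutation matrix is block diagonal, so the parities add up by
    multiplicativity of the determinant. *)
Lemma odd_block_perm s t : odd_perm (block_perm s t) = s (+) t :> bool.
Proof.
have E : perm_mx (block_perm s t) = block_mx (perm_mx s) 0 0 (perm_mx t) :> 'M[int]_(k + m).
  apply/matrixP => i j; case: (split_ordP i) => a ->; case: (split_ordP j) => b ->;
    rewrite ?(block_mxEul, block_mxEur, block_mxEdl, block_mxEdr) !mxE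
            ?block_permL ?block_permR.
  - by rewrite (inj_eq (@lshift_inj _ _)).
  - by rewrite eq_lrshift.
  - by rewrite eq_rlshift.
  - by rewrite (inj_eq (@rshift_inj _ _)).
have := det_perm int (block_perm s t).
by rewrite E det_ublock !det_perm -signr_addb => /Num.Theory.signr_inj.
Qed.

Lemma block_permP (h : 'S_(k + m)) :
  (forall i, (h i < k)%N = (i < k)%N) -> exists s t, h = block_perm s t.
Proof.
move=> hk.
have hl a : exists b, h (lshift m a) = lshift m b.
  have: (h (lshift m a) < k)%N by rewrite hk /= ltn_ord.
  by case: (split_ordP (h (lshift m a))) => // b ->; exists b.
have hr a : exists b, h (rshift k a) = rshift k b.
  have: (h (rshift k a) < k)%N = false by rewrite hk /= ltnNge leq_addr.
  by case: (split_ordP (h (rshift k a))) => // b ->; exists b.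
have [s0 hs0] := fin_all_exists hl; have [t0 ht0] := fin_all_exists hr.
have s0_inj : injective s0.
  by move=> a b ab; apply/(@lshift_inj k m)/(@perm_inj _ h); rewrite !hs0 ab.
have t0_inj : injective t0.
  by move=> a b ab; apply/(@rshift_inj k m)/(@perm_inj _ h); rewrite !ht0 ab.
exists (perm s0_inj), (perm t0_inj); apply/permP => i.
case: (split_ordP i) => a ->.
  by rewrite block_permL permE hs0.
by rewrite block_permR permE ht0.
Qed.

Lemma block_perm_inj s t s' t' :
  block_perm s t = block_perm s' t' -> (s, t) = (s', t').
Proof.
move=> E; congr (_, _); apply/permP => i.
  by apply: (@lshift_inj k m); rewrite -(block_permL s t) E block_permL.
by apply: (@rshift_inj k m); rewrite -(block_permR s t) E block_permR.
Qed.

End BlockPermutations.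

Section Decompositions.

(** The Grassmannian permutations are representatives of the cosets of
    the block permutations: [u] lies in the coset of the [w] with the same set
    of values on the first [k] positions. *)
Lemma perm_decomposition k m (V : nmodType) (F : 'S_(k + m) -> V) :
  \sum_u F u = \sum_(w | grassmannian k w) \sum_s \sum_t F (block_perm s t * w)%g.
Proof.
pose h (p : 'S_(k + m) * ('S_k * 'S_m)) := (block_perm p.2.1 p.2.2 * p.1)%g.
under [RHS]eq_bigr => w _ do rewrite pair_bigA.
rewrite (pair_big_dep (fun w => grassmannian k w) (fun _ _ => true)
   (fun w st => F (block_perm st.1 st.2 * w)%g)) /=.
have blk (s : 'S_k) (t : 'S_m) i : (block_perm s t i < k)%N = (i < k)%N.
  case: (split_ordP i) => a ->; rewrite ?block_permL ?block_permR.
    by rewrite /= ltn_ord.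
  by rewrite ltnNge /= leq_addr.
have kn := leq_addr m k.
have h_inj : {in [set p | grassmannian k p.1] &, injective h}.
  move=> [w [s t]] [w' [s' t']]; rewrite !inE /h /= => gw gw' E.
  have ww' : w = w'.
    apply: (grassmannian_unique kn gw gw') => x.
    have inv_w (b v : 'S_(k + m)) : (v^-1)%g x = b ((b * v)^-1 x)%g.
      by rewrite invMg permM permKV.
    by rewrite (inv_w (block_perm s t)) blk E (inv_w (block_perm s' t') w') blk.
  by move: E; rewrite -ww' => /mulIg/block_perm_inj[-> ->].
transitivity (\sum_(u in h @: [set p | grassmannian k p.1]) F u); last first.
  by rewrite big_imset //=; apply: eq_bigl => p; rewrite inE andbT.
apply: eq_bigl => u; apply/esym/imsetP.
have [w] := grassmannian_exists [set u (lshift m a) | a : 'I_k].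
rewrite card_imset ?card_ord; last exact: inj_comp (@perm_inj _ u) (@lshift_inj k m).
move=> gw wS; have [|s [t st]] := @block_permP k m (u * w^-1)%g.
  move=> i; rewrite permM -wS permKV; case: (split_ordP i) => a ->.
    by rewrite imset_f.
  apply/imsetP => -[b _ /perm_inj/eqP].
  by rewrite eq_rlshift.
by exists (w, (s, t)); rewrite ?inE // /h /= -st mulgKV.
Qed.

(** An injective multi-index is a rearrangement of a unique increasing
    one, and increasing multi-indices are the first halves of Grassmannian
    permutations. *)
Lemma injective_decomposition k n (kn : (k <= n)%N) (V : nmodType)
    (F : {ffun 'I_k -> 'I_n} -> V) :
  \sum_(a : {ffun 'I_k -> 'I_n} | injectiveb a) F a
    = \sum_(w : 'S_n | grassmannian k w) \sum_(s : 'S_k)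
        F [ffun j => w (widen_ord kn (s j))].
Proof.
pose h (p : 'S_n * 'S_k) := [ffun j => p.1 (widen_ord kn (p.2 j))].
rewrite (pair_big_dep (fun w => grassmannian k w) (fun _ _ => true)
   (fun w s => F (h (w, s)))) /=.
have h_inj : {in [set p | grassmannian k p.1] &, injective h}.
  move=> [w s] [w' s']; rewrite !inE /= => gw gw' /ffunP E.
  have {}E j : w (widen_ord kn (s j)) = w' (widen_ord kn (s' j)).
    by have := E j; rewrite !ffunE.
  have half (u u' : 'S_n) (s1 s1' : 'S_k) :
      (forall j, u (widen_ord kn (s1 j)) = u' (widen_ord kn (s1' j))) ->
      forall x, ((u^-1)%g x < k)%N -> ((u'^-1)%g x < k)%N.
    move=> Eu x ux; pose j := (s1^-1)%g (Ordinal ux).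
    have -> : x = u' (widen_ord kn (s1' j)).
      rewrite -Eu /j permKV; apply: (@perm_inj _ (u^-1)%g).
      by rewrite permK; apply: val_inj.
    by rewrite permK /= ltn_ord.
  have ww' : w = w'.
    apply: (grassmannian_unique kn gw gw') => x.
    by apply/idP/idP; apply: half; [exact: E | move=> j; exact/esym/E].
  rewrite -ww'; congr (_, _); apply/permP => j.
  by have := E j; rewrite -ww' => /perm_inj/(congr1 val) => /= /val_inj.
transitivity (\sum_(a in h @: [set p | grassmannian k p.1]) F a); last first.
  by rewrite big_imset //=; apply: eq_bigl => p; rewrite inE andbT.
apply: eq_bigl => a; apply/injectiveP/imsetP => [a_inj|[[w s] _ ->] i j]; last first.
  by rewrite !ffunE => /perm_inj/(congr1 val) => /= /val_inj/perm_inj.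
have [w] := grassmannian_exists (a @: setT).
rewrite card_imset ?cardsT ?card_ord // => gw wS.
have wa j : ((w^-1)%g (a j) < k)%N by rewrite -wS permKV imset_f.
pose s0 j := Ordinal (wa j).
have s0_inj : injective s0.
  by move=> i j /(congr1 val) => /= /val_inj/perm_inj/a_inj.
exists (w, perm s0_inj); rewrite ?inE //; apply/ffunP => j.
rewrite ffunE /= permE -[LHS](permKV w); congr (w _).
exact: val_inj.
Qed.

End Decompositions.

(** The parity of [w] is that of the number of its inversions, which is
    the sum of [i - w i] over the second block.  The induction removes the last
    position: this permutation of [n] letters differs from [w] by a cycle of
    parity [n + w n], and the values that precede in the second block are below
    [w n], hence do not change. *)
Lemma odd_grassmannian n k (w : 'S_n) : (k <= n)%N -> grassmannian k w ->
  odd_perm w = odd (\sum_(i < n | (k <= i)%N) (w i + i)).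
Proof.
move=> kn /(grassmannianP kn).
elim: n k kn w => [|n IH] k kn w inc.
  rewrite big_ord0; have -> : w = 1%g by apply/permP => -[].
  by rewrite odd_perm1.
move: kn; rewrite leq_eqVlt ltnS => /predU1P[kn|kn].
  rewrite big_pred0 => [|i]; last by rewrite kn leqNgt ltn_ord.
  rewrite (@increasing_perm1 _ w) ?odd_perm1 // => i j ij.
  by apply: inc => //; rewrite kn ltn_ord.
(* The induced permutation of the remaining positions and values. *)
pose f i := odflt i (unlift (w ord_max) (w (lift ord_max i))).
have fE i : lift (w ord_max) (f i) = w (lift ord_max i).
  rewrite /f; case: unliftP => [j -> //|/perm_inj/eqP].
  by rewrite eq_sym (negbTE (neq_lift _ _)).
have f_inj : injective f.
  by move=> i j /(congr1 (lift (w ord_max))); rewrite !fE => /perm_inj/lift_inj.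
pose s := perm f_inj.
have wE : w = lift_perm ord_max (w ord_max) s.
  apply/permP => i; case: (unliftP ord_max i) => [j|] ->.
    by rewrite lift_perm_lift permE fE.
  by rewrite lift_perm_id.
have liftE (i : 'I_n) : lift ord_max i = i :> nat by rewrite /= /bump leqNgt ltn_ord.
rewrite big_mkcond big_ord_recr /= kn [in LHS]wE odd_lift_perm (IH k) //.
  rewrite -big_mkcond /= oddD [RHS]addbC; congr (_ (+) _).
    by rewrite oddD addbC.
  congr odd; apply: eq_bigr => i ki.
  have -> : widen_ord (leqnSn n) i = lift ord_max i by apply: val_inj; exact/esym/liftE.
  congr (_ + _)%N.
  have := inc (lift ord_max i) ord_max; rewrite liftE ki orbT ltn_ord => /(_ isT isT).
  rewrite -fE permE /= /bump; lia.
move=> i j ij block.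
have := inc (lift ord_max i) (lift ord_max j); rewrite !liftE => /(_ ij block).
by rewrite -!fE !permE /= /bump; lia.
Qed.

(** * Laplace expansion along the first columns *)

Section Laplace.
Variable A : comNzRingType.

Lemma det_scale_rows n (c : 'I_n -> A) (M : 'M[A]_n) :
  \det (\matrix_(i, j) (c i * M i j)) = \prod_i c i * \det M.
Proof.
have -> : \matrix_(i, j) (c i * M i j) = diag_mx (\row_i c i) *m M.
  by apply/matrixP => i j; rewrite mul_diag_mx !mxE.
by rewrite det_mulmx det_diag; congr (_ * _); apply: eq_bigr => i _; rewrite mxE.
Qed.

(** Both sides are the Vandermonde determinant, the rows on the right
    being in decreasing order of exponents as in [vandermonde_prod]. *)
Lemma vandermonde_rev n (x : 'I_n -> A) :
  \prod_(i < n) \prod_(j < n | (i < j)%N) (x j - x i)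
    = (-1) ^+ perm (@rev_ord_inj n)
      * \prod_(i < n) \prod_(j < n | (i < j)%N) (x i - x j).
Proof.
rewrite -vandermonde_prod -det_rev_rows.
transitivity (\det (Vandermonde n (\row_j x j))).
  rewrite det_Vandermonde.
  by apply: eq_bigr => i _; apply: eq_bigr => j _; rewrite !mxE.
congr (\det _); apply/matrixP => i j; rewrite !mxE /=; congr (_ ^+ _).
by have := ltn_ord i; lia.
Qed.

Lemma vandermonde_opp n (x : 'I_n -> A) :
  \prod_(i < n) \prod_(j < n | (i < j)%N) (- x j - - x i)
    = \prod_(i < n) (-1) ^+ i
      * \prod_(i < n) \prod_(j < n | (i < j)%N) (x j - x i).
Proof.
transitivity (\det (Vandermonde n (\row_j (- x j)))).
  rewrite det_Vandermonde.
  by apply: eq_bigr => i _; apply: eq_bigr => j _; rewrite !mxE.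
transitivity (\prod_(i < n) (-1) ^+ i * \det (Vandermonde n (\row_j x j))).
  rewrite -det_scale_rows; congr (\det _); apply/matrixP => i j; rewrite !mxE.
  exact: exprNn.
rewrite det_Vandermonde; congr (_ * _).
by apply: eq_bigr => i _; apply: eq_bigr => j _; rewrite !mxE.
Qed.

(** In the Leibniz formula, collect the permutations by cosets of the
    block permutations; the sum over a coset splits into two Leibniz
    formulas. *)
Lemma det_laplace k m (M : 'M[A]_(k + m)) :
  \det M = \sum_(w : 'S_(k + m) | grassmannian k w) (-1) ^+ w
    * \det (\matrix_(i < k, j < k) M (w (lshift m i)) (lshift m j))
    * \det (\matrix_(i < m, j < m) M (w (rshift k i)) (rshift k j)).
Proof.
rewrite -det_tr [LHS]/determinant perm_decomposition; apply: eq_bigr => w _.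
have minorE r (g : 'I_r -> 'I_(k + m)) :
    \det (\matrix_(i < r, j < r) M (w (g i)) (g j))
      = \sum_(s : 'S_r) (-1) ^+ s * \prod_i M (w (g (s i))) (g i).
  rewrite -det_tr; apply: eq_bigr => s _; congr (_ * _).
  by apply: eq_bigr => i _; rewrite !mxE.
rewrite (minorE k (lshift m)) (minorE m (@rshift k m)) -mulrA big_distrlr.
rewrite mulr_sumr /=; apply: eq_bigr => s _.
rewrite mulr_sumr; apply: eq_bigr => t _.
rewrite odd_permM odd_block_perm (signr_addb _ (s (+) t) w) (signr_addb _ s t).
rewrite big_split_ord /=.
transitivity ((-1) ^+ s * (-1) ^+ t * (-1) ^+ w
    * ((\prod_i M (w (lshift m (s i))) (lshift m i))
       * \prod_i M (w (rshift k (t i))) (rshift k i)) : A).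
  congr (_ * (_ * _)); apply: eq_bigr => i _; rewrite mxE permM.
    by rewrite block_permL.
  by rewrite block_permR.
rewrite [in RHS]mulrACA [RHS]mulrA; congr (_ * _); exact: mulrC.
Qed.

End Laplace.

(** * The dual Cauchy identity for factorial Schur polynomials *)

(** This makes the division by the Vandermonde product unambiguous over an
    arbitrary coefficient ring: the leading coefficient of ['X_i - 'X_j] is a
    sign. *)
Lemma vdm_lreg (L : comNzRingType) k : GRing.lreg (vdm L k).
Proof.
have lreg_sub (i j : 'I_k) : i != j -> GRing.lreg ('X_i - 'X_j : {mpoly L[k]}).
  move=> ij; have neqU : U_(i)%MM != U_(j)%MM.
    apply: contra ij => /eqP/mnmP/(_ i); rewrite !mnm1E eqxx.
    by rewrite eq_sym; case: eqP.
  apply: lreg_mleadc.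
  case: (Order.TotalTheory.ltgtP U_(i)%MM U_(j)%MM) (neqU) => // lt _.
    rewrite mleadDr ?mleadN ?mleadXm // mcoeffB !mcoeffX eqxx.
    by rewrite (negbTE neqU) sub0r; apply: lregN; exact: lreg1.
  rewrite mleadDl ?mleadN ?mleadXm // mcoeffB !mcoeffX eqxx.
  by rewrite eq_sym (negbTE neqU) subr0; exact: lreg1.
have lreg_big := big_ind (@GRing.lreg _) (@lreg1 {mpoly L[k]}) (@lregM {mpoly L[k]}).
apply: (lreg_big) => i _; apply: (lreg_big) => j ij; apply: lreg_sub.
by rewrite -val_eqE neq_ltn ij.
Qed.

Lemma sorted_ltn_nth_ge (s : seq nat) j :
  sorted ltn s -> (j < size s)%N -> (j <= nth 0 s j)%N.
Proof.
move=> s_sorted; elim: j => // j IH j1s.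
apply: leq_ltn_trans (IH (ltnW j1s)) _.
by apply: (sorted_ltn_nth ltn_trans 0%N s_sorted); rewrite ?inE // ltnW.
Qed.

(** Since [lambda_i + k - i = w_(k+1-i) - 1], the bialternant of
    [lambda(w)] has the values of [w] as exponents.  The first block of [wstar k w] is the second
    block of [w], so that the lemma applies to both. *)
Lemma schubert_minor (L : comNzRingType) (y : nat -> L) n k (w : 'S_n) :
    (k <= n)%N -> sorted ltn (take k (oneline w)) ->
  sym_val (schubert y k w) * vdm L k
    = (-1) ^+ perm (@rev_ord_inj k)
      * \det (\matrix_(i < k, j < k) facpow y j (nth 0%N (oneline w) i)).
Proof.
move=> kn inc; rewrite /schubert fschurP -det_rev_rows; congr (\det _).
apply/matrixP => i j; rewrite !mxE /=; congr (facpow _ _ _).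
rewrite /grass_part ltn_ord subnK //.
have lt_k : (k - i.+1 < k)%N by have := ltn_ord i; lia.
rewrite -(nth_take 0%N lt_k); apply: sorted_ltn_nth_ge inc _.
by rewrite size_takel ?size_oneline.
Qed.

(** Compares the signs of the term [w] of the Laplace expansion: its own,
    and those that replace [(-x|y)^e] by [(x|-y)^e] in its second minor.  Their
    product does not depend on [w]; the right hand side is the sign that the
    Vandermonde determinant produces from the same substitution. *)
Lemma sign_grassmannian (A : comNzRingType) k m (w : 'S_(k + m)) :
    grassmannian k w ->
  (-1) ^+ w * \prod_(b < m) (-1) ^+ (w (rshift k b))
    = \prod_(a < k) \prod_(b < m) (-1) * \prod_(b < m) (-1) ^+ b :> A.
Proof.
move=> /(odd_grassmannian (leq_addr m k)) ->; rewrite signr_odd.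
rewrite big_split_ord /= big_pred0 => [|a]; last by rewrite leqNgt ltn_ord.
rewrite add0n (eq_bigl predT) => [|b]; last by rewrite leq_addr.
rewrite -prodrXr -big_split exchange_big -big_split; apply: eq_bigr => b _ /=.
rewrite prodr_const card_ord -!exprD addnAC addnn exprD.
by rewrite -mul2n exprM sqrrN !expr1n mul1r.
Qed.

Section DualCauchy.
Variables (L : comNzRingType) (y : nat -> L) (k m : nat).
Local Notation B := {mpoly {mpoly L[k]}[m]}.

Let xi (a : 'I_k) : B := ('X_a)%:MP.
Let x (b : 'I_m) : B := 'X_b.
(** The [n] unknowns of the Vandermonde determinant.  The minus sign turns
    the differences between the two groups of unknowns into the factors
    [x_b + xi_a]. *)
Let z (j : 'I_(k + m)) : B :=
  match split j with inl a => xi a | inr b => - x b end.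

Let zL a : z (lshift m a) = xi a. Proof. by rewrite /z (unsplitK (inl a)). Qed.
Let zR b : z (rshift k b) = - x b. Proof. by rewrite /z (unsplitK (inr b)). Qed.

Let facz (e : nat) (j : 'I_(k + m)) : B := \prod_(l < e) (z j - (y l)%:MP%:MP).

Let faczL e a : facz e (lshift m a) = (facpow y a e)%:MP.
Proof.
rewrite /facz zL /facpow rmorph_prod; apply: eq_bigr => l _.
by rewrite rmorphB.
Qed.

Let faczR e b :
  facz e (rshift k b)
    = (-1) ^+ e * map_mpoly (@mpolyC k L) (facpow (fun i => - y i) b e).
Proof.
rewrite /facz zR /facpow rmorph_prod -[X in _ ^+ X](card_ord e) -prodr_const.
rewrite -big_split; apply: eq_bigr => l _ /=.
rewrite rmorphB /= map_mpolyX map_mpolyC /= mulN1r opprB addrC; congr (_ - _).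
by rewrite !rmorphN.
Qed.

Let map_vdm : map_mpoly (@mpolyC k L) (vdm L m) = vdm {mpoly L[k]} m.
Proof.
rewrite rmorph_prod; apply: eq_bigr => i _; rewrite rmorph_prod.
by apply: eq_bigr => j _; rewrite rmorphB /= !map_mpolyX.
Qed.

Lemma dual_cauchy :
  \prod_(b < m) \prod_(a < k) ('X_b + ('X_a)%:MP : B)
    = \sum_(w : 'S_(k + m) | grassmannian k w)
        (sym_val (schubert y k w))%:MP
        * map_mpoly (@mpolyC k L)
            (sym_val (schubert (fun i => - y i) m (wstar k w))).
Proof.
pose sg r : B := (-1) ^+ perm (@rev_ord_inj r).
have sg2 r : sg r * sg r = 1 by rewrite -expr2 sqrr_sign.
(* The sign that the substitution of [-x] produces in the Vandermonde product. *)
pose c : B := \prod_(a < k) \prod_(b < m) (-1) * \prod_(b < m) (-1) ^+ b.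
pose V1 : B := (vdm L k)%:MP; pose V2 : B := vdm {mpoly L[k]} m.
pose N : 'M[B]_(k + m) := \matrix_(i, j) facz i j.
pose D := \det N.
have D_prod : D = c * sg k * sg m * (V1 * V2)
    * \prod_(b < m) \prod_(a < k) ('X_b + ('X_a)%:MP : B).
  have -> : D = \prod_(i < k + m) \prod_(j < k + m | (i < j)%N) (z j - z i).
    rewrite -(det_monic_eval (p := fun i : 'I_(k + m) =>
      facpoly (fun l => (y l)%:MP%:MP : B) i)) => [||i].
    - congr (\det _); apply/matrixP => i j; rewrite !mxE.
      by rewrite horner_facpoly.
    - by move=> i; exact: facpoly_monic.
    - exact: size_facpoly.
  rewrite big_split_ord /=.
  under eq_bigr => a _.
    rewrite big_split_ord /= [X in _ * X](eq_bigl predT); last first.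
      by move=> b; rewrite ltn_addr ?ltn_ord.
    rewrite zL; under eq_bigr => a' _ do rewrite zL.
    under [X in _ * X]eq_bigr => b _ do rewrite zR -opprD -mulN1r.
    rewrite [X in _ * X]big_split /=.
    over.
  under [X in _ * X]eq_bigr => b _.
    rewrite big_split_ord /= big_pred0; last first.
      by move=> a; rewrite ltnNge leq_eqVlt ltn_addr ?orbT ?ltn_ord.
    rewrite mul1r (eq_bigl (fun b' : 'I_m => (b < b')%N)) => [|b']; last first.
      by rewrite ltn_add2l.
    rewrite zR; under eq_bigr => b' _ do rewrite zR.
    over.
  rewrite !big_split /= vandermonde_opp !vandermonde_rev -/(sg k) -/(sg m).
  rewrite [X in _ = _ * X]exchange_big /=.
  have -> : V1 = \prod_(i < k) \prod_(j < k | (i < j)%N) (xi i - xi j).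
    rewrite /V1 rmorph_prod; apply: eq_bigr => i _; rewrite rmorph_prod.
    by apply: eq_bigr => j _; rewrite rmorphB.
  rewrite /c /V2 /vdm /xi /x.
  set p1 := \prod_(i < k) \prod_(j < k | _) _.
  set p2 := \prod_(i < m) \prod_(j < m | _) _.
  set p3 := \prod_(i < k) \prod_(j < m) (_ + _).
  set p4 := \prod_(i < k) \prod_(j < m) (-1).
  set p5 := \prod_(i < m) (-1) ^+ _.
  move: (sg k) (sg m) p1 p2 p3 p4 p5; clear => s1 s2 p1 p2 p3 p4 p5.
  by ring.
have minorL w : grassmannian k w ->
    \det (\matrix_(i < k, j < k) N (w (lshift m i)) (lshift m j))
      = sg k * ((sym_val (schubert y k w))%:MP * V1).
  case/andP=> inc _; rewrite -rmorphM /= schubert_minor ?leq_addr //.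
  rewrite rmorphM rmorphXn rmorphN1 mulrA sg2 mul1r -det_map_mx.
  congr (\det _); apply/matrixP => i j; rewrite !mxE faczL.
  by rewrite -nth_oneline.
have minorR w : grassmannian k w ->
    \det (\matrix_(i < m, j < m) N (w (rshift k i)) (rshift k j))
      = \prod_(b < m) (-1) ^+ (w (rshift k b))
        * (sg m * (map_mpoly (@mpolyC k L)
                     (sym_val (schubert (fun i => - y i) m (wstar k w))) * V2)).
  case/andP=> _ inc; have szn := size_oneline w.
  (* The one-line notation of [wstar k w] starts with the second block of [w]. *)
  have take_rot : take m (oneline (wstar k w)) = drop k (oneline w).
    rewrite oneline_wstar ?leq_addr // /rot take_size_cat //.
    by rewrite size_drop szn addKn.
  rewrite /V2 -map_vdm -rmorphM /= schubert_minor ?leq_addl ?take_rot //.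
  rewrite rmorphM rmorphXn rmorphN1 (mulrA (sg m)) sg2 mul1r -det_map_mx.
  rewrite -det_scale_rows; congr (\det _); apply/matrixP => i j; rewrite !mxE faczR.
  congr (_ * map_mpoly _ (facpow _ _ _)).
  by rewrite -(nth_take 0%N (ltn_ord i)) take_rot nth_drop -nth_oneline.
(* What both sides are multiplied by is regular. *)
have reg : GRing.lreg (c * sg k * sg m * (V1 * V2)).
  apply: lregM; last apply: lregM; last exact: vdm_lreg.
    apply/lregM/lreg_sign/lregM/lreg_sign; rewrite /c !prodr_const prodrXr.
    by apply: lregM; [apply/lregX|]; apply: lreg_sign.
  by apply: lreg_mleadc; rewrite mleadcC; exact: vdm_lreg.
apply: reg; rewrite -D_prod /D det_laplace mulr_sumr; apply: eq_bigr => w gw.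
rewrite minorL // minorR // /c -(sign_grassmannian _ gw).
(* Associativity and commutativity only, over variables to keep the terms small. *)
have regroup (e f s1 s2 g1 g2 v1 v2 : B) :
    e * (g1 * (s1 * v1)) * (f * (g2 * (s2 * v2)))
      = e * f * g1 * g2 * (v1 * v2) * (s1 * s2) by clear; ring.
exact: regroup.
Qed.

End DualCauchy.

(** * Antisymmetrization divided by the Vandermonde product *)

Section Antisymmetrization.
Variables (L : comNzRingType) (k : nat).
Implicit Types p : {mpoly L[k]}.

(** The sign of the reversal normalizes the operator so that increasing
    exponents give Schubert polynomials ([divdiff_schubert]). *)
Definition antisym p : {mpoly L[k]} :=
  (-1) ^+ perm (@rev_ord_inj k) * \sum_(s : 'S_k) (-1) ^+ s * msym s p.

Lemma antisym_is_linear : linear antisym.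
Proof.
move=> c p p'; rewrite /antisym scalerAr -mulrDr scaler_sumr -big_split /=.
by congr (_ * _); apply: eq_bigr => s _; rewrite msymD msymZ mulrDr scalerAr.
Qed.

HB.instance Definition _ :=
  GRing.isLinear.Build L {mpoly L[k]} {mpoly L[k]} *:%R antisym antisym_is_linear.

Lemma antisym_symM (f : sympoly L k) p :
  antisym (sym_val f * p) = sym_val f * antisym p.
Proof.
rewrite /antisym mulrCA; congr (_ * _); rewrite mulr_sumr; apply: eq_bigr => s _.
rewrite msymM mulrCA; congr (_ * (_ * _)).
by have /issymP := valP f; apply.
Qed.

Lemma antisym_prod (F : 'I_k -> 'I_k -> {mpoly L[k]}) :
    (forall (s : 'S_k) i j, msym s (F i j) = F i (s j)) ->
  antisym (\prod_i F i i)
    = (-1) ^+ perm (@rev_ord_inj k) * \det (\matrix_(i, j) F i j).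
Proof.
move=> symF; congr (_ * _); apply: eq_bigr => s _; congr (_ * _).
by rewrite rmorph_prod; apply: eq_bigr => i _; rewrite mxE -symF.
Qed.

(** By linearity it suffices to antisymmetrize a monomial, which gives a
    bialternant. *)
Lemma antisym_divisible p :
  exists q : sympoly L k, sym_val q * vdm L k = antisym p.
Proof.
rewrite {1}[p]mpolyE linear_sum /=.
elim/big_ind: _ => [|_ _ [q1 <-] [q2 <-]|m _].
- by exists 0; rewrite mul0r.
- by exists (q1 + q2); rewrite mulrDl.
have [C detC symC] := bialternant_quot (fun j : 'I_k => 'X_j : {mpoly L[k]})
  (fun=> 0) (fun i : 'I_k => m i).
have C_sym : \det C \in @symmetric_pred k L.
  apply/issymP => s; apply: (symC (msym s) s) => [i|l].
    by rewrite /= /msym mmapX mmap1U.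
  by rewrite /= msym0.
exists (p@_m *: SymPoly C_sym); rewrite linearZ /= -scalerAl; congr (_ *: _).
have -> : 'X_[m] = \prod_i \prod_(l < m i) ('X_i - 0) :> {mpoly L[k]}.
  rewrite mpolyXE_id; apply: eq_bigr => i _.
  by under eq_bigr do rewrite subr0; rewrite prodr_const card_ord.
rewrite (antisym_prod (F := fun i j => \prod_(l < m i) ('X_j - 0))); last first.
  move=> s i j; rewrite rmorph_prod; apply: eq_bigr => l _.
  by rewrite !subr0 /= /msym mmapX mmap1U.
rewrite detC det_Vandermonde mulrCA; congr (_ * _).
under eq_bigr => i _ do under eq_bigr => j _ do rewrite !mxE.
by rewrite vandermonde_rev mulrA -expr2 sqrr_sign mul1r.
Qed.

(** Up to sign, the divided difference operator of the longest
    permutation. *)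
Definition divdiff p : sympoly L k := sval (cid (antisym_divisible p)).

Lemma divdiffP p : sym_val (divdiff p) * vdm L k = antisym p.
Proof. exact: svalP (cid (antisym_divisible p)). Qed.

Lemma divdiff_unique p q : sym_val q * vdm L k = antisym p -> divdiff p = q.
Proof.
move=> qP; apply: val_inj; apply: (@vdm_lreg L k).
by rewrite mulrC divdiffP -qP mulrC.
Qed.

Lemma divdiff_is_linear : linear divdiff.
Proof.
move=> c p p'; apply: divdiff_unique.
rewrite antisym_is_linear -(divdiffP p) -(divdiffP p') scalerAl -mulrDl.
by [].
Qed.

HB.instance Definition _ :=
  GRing.isLinear.Build L {mpoly L[k]} (sympoly L k) *:%R divdiff divdiff_is_linear.

(** This linearity is what makes the operator compatible with the ideal
    that defines [qH], whose generators are symmetric. *)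
Lemma divdiff_symM (f : sympoly L k) p : divdiff (sym_val f * p) = f * divdiff p.
Proof. by apply: divdiff_unique; rewrite /= -mulrA divdiffP antisym_symM. Qed.

Variable y : nat -> L.

(** The image of the tensor [v_(e 0) (x) ... (x) v_(e (k-1))] under the
    identification of tensors with polynomials. *)
Definition facmono (e : 'I_k -> nat) : {mpoly L[k]} := \prod_i facpow y i (e i).

Lemma antisym_facmono e :
  antisym (facmono e)
    = (-1) ^+ perm (@rev_ord_inj k) * \det (\matrix_(i, j) facpow y j (e i)).
Proof.
rewrite (antisym_prod (F := fun i j => facpow y j (e i))) // => s i j.
rewrite rmorph_prod; apply: eq_bigr => l _.
by rewrite rmorphB /= /msym mmapX mmap1U mmapC.
Qed.

Lemma divdiff_facmono_perm e (s : 'S_k) :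
  divdiff (facmono (fun i => e (s i))) = (-1) ^+ s *: divdiff (facmono e).
Proof.
apply: divdiff_unique; rewrite /= -scalerAl divdiffP !antisym_facmono.
rewrite -mul_mpolyC rmorphXn rmorphN1 mulrCA; congr (_ * _).
rewrite -det_perm -det_mulmx -row_permE; congr (\det _).
by apply/matrixP => i j; rewrite !mxE.
Qed.

Lemma divdiff_facmono_repeat e i j : i != j -> e i = e j -> divdiff (facmono e) = 0.
Proof.
move=> ij eij; apply: divdiff_unique; rewrite mul0r antisym_facmono.
rewrite [X in _ * X](determinant_alternate ij) ?mulr0 // => l.
by rewrite !mxE eij.
Qed.

Lemma divdiff_schubert n (kn : (k <= n)%N) (w : 'S_n) : grassmannian k w ->
  divdiff (facmono (fun i => w (widen_ord kn i))) = schubert y k w.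
Proof.
case/andP=> inc _; apply: divdiff_unique.
rewrite antisym_facmono (schubert_minor y kn inc).
congr (_ * \det _); apply/matrixP => i j; rewrite !mxE.
by rewrite -nth_oneline.
Qed.

Lemma vdm_det_monic (p : 'I_k -> {poly {mpoly L[k]}}) :
    (forall i, p i \is monic) -> (forall i, size (p i) = i.+1) ->
  \det (\matrix_(i, j) (p (rev_ord i)).['X_j]) = vdm L k.
Proof.
move=> p_monic size_p.
have -> : \matrix_(i, j) (p (rev_ord i)).['X_j]
    = \matrix_(i, j) (\matrix_(i', j') (p i').['X_j']) (rev_ord i) j.
  by apply/matrixP => i j; rewrite !mxE.
rewrite det_rev_rows det_monic_eval // vandermonde_rev mulrA -expr2 sqrr_sign.
by rewrite mul1r.
Qed.

Lemma facpowE (j : 'I_k) m : facpow y j m = (facpoly (fun l => (y l)%:MP) m).['X_j].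
Proof. by rewrite horner_facpoly. Qed.

Lemma schubert1 n : (k <= n)%N -> schubert y k (1%g : 'S_n) = 1.
Proof.
move=> kn; apply: val_inj; apply: (@vdm_lreg L k); rewrite /= mulr1 mulrC fschurP.
rewrite -[RHS](vdm_det_monic (p := fun i : 'I_k => facpoly (fun l => (y l)%:MP) i)).
- congr (\det _); apply/matrixP => i j; rewrite !mxE -facpowE /grass_part ltn_ord.
  have lt_n : (k - i.+1 < n)%N by have := ltn_ord i; lia.
  by rewrite (nth_oneline _ (Ordinal lt_n)) perm1 subnn add0n.
- by move=> i; exact: facpoly_monic.
- by move=> i; exact: size_facpoly.
Qed.

End Antisymmetrization.

(** * The defining relations of the quantum cohomology ring *)

Section OneRowRelations.
Variables (L : comNzRingType) (y : nat -> L) (n k : nat).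
Hypotheses (k_gt0 : (0 < k)%N) (kn : (k <= n)%N).
Hypothesis y_ge : forall i, (n <= i)%N -> y i = 0.
Local Notation A := {mpoly L[k]}.

(** Beyond the [n]-th, the factors of a factorial power are the variable
    itself; this is what allows Lagrange interpolation in [facpow_fhom]. *)
Lemma facpow_shift (j : 'I_k) i : facpow y j (n + i) = facpow y j n * 'X_j ^+ i.
Proof.
rewrite /facpow big_split_ord /=; congr (_ * _).
rewrite -[X in _ ^+ X](card_ord i) -prodr_const; apply: eq_bigr => l _.
by rewrite y_ge ?leq_addr // mpolyC0 subr0.
Qed.

Let i0 : 'I_k := Ordinal k_gt0.

(** The matrix whose determinant is the bialternant of a one-row partition,
    with its top row made arbitrary; [cof j] is the cofactor of the [j]-th
    entry of that row, so that the determinant is linear in [f]. *)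
Let toprow_mx (f : 'I_k -> A) : 'M[A]_k :=
  \matrix_(i, j) if i == i0 then f j else facpow y j (k - i.+1).
Let cof (j : 'I_k) : A := cofactor (toprow_mx (fun=> 0)) i0 j.

Let det_toprow f : \det (toprow_mx f) = \sum_j f j * cof j.
Proof.
rewrite (expand_det_row _ i0); apply: eq_bigr => j _; rewrite mxE eqxx.
congr (_ * (_ * \det _)); apply/matrixP => a b; rewrite !mxE.
by rewrite (eq_sym _ i0) (negbTE (neq_lift _ _)).
Qed.

Let fhom_det r :
  sym_val (fhom y k r) * vdm L k = \det (toprow_mx (fun j => facpow y j (r + k.-1))).
Proof.
rewrite /fhom fschurP; congr (\det _); apply/matrixP => i j; rewrite !mxE.
case: eqP => [->|/eqP]; first by rewrite /= subn1.
by rewrite -val_eqE; case: i => -[|i] //= ik _; rewrite add0n.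
Qed.

(** By [det_toprow] and [facpow_shift], up to the Vandermonde product
    [h_(n-k+i+1)] is the sum over [l] of [(xi_l|y)^n xi_l^i cof_l].  A
    combination of these with coefficients [C`_i] therefore has the terms
    [(xi_l|y)^n C(xi_l) cof_l], and the Lagrange polynomial [C] that vanishes
    at every [xi_l], [l <> j], isolates [(xi_j|y)^n].  That [C] is monic of
    degree [k-1] gives [C(xi_j) cof_j] its value, the Vandermonde product, and
    makes the coefficient of [h_n] equal to 1. *)
Lemma facpow_fhom (j : 'I_k) :
  exists2 c : 'I_k -> A, c (rev_ord i0) = 1
    & facpow y j n = \sum_(i < k) c i * sym_val (fhom y k (n - k + i.+1)).
Proof.
(* The Lagrange polynomial: the product of the [z - xi_l] for [l <> j]. *)
have [C [C_monic size_C C0]] : exists C : {poly A},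
    [/\ C \is monic, size C = k & forall l, l != j -> C.['X_l] = 0].
  exists (\prod_(l <- rem j (enum 'I_k)) ('X - ('X_l)%:P)); split.
  - exact: monic_prod_XsubC.
  - by rewrite size_prod_XsubC size_rem ?mem_enum // size_enum_ord prednK.
  move=> l lj; have l_in : l \in rem j (enum 'I_k).
    by rewrite mem_rem_uniq ?enum_uniq // inE lj mem_enum.
  exact: (horner_prod_XsubC_eq0 (fun l : 'I_k => 'X_l : A) l_in).
have C_row f : \sum_l f l * C.['X_l] * cof l = f j * (C.['X_j] * cof j).
  rewrite (bigD1 j) //= big1 ?addr0 ?mulrA // => l lj.
  by rewrite C0 // mulr0 mul0r.
(* Top row [C(xi_l)]: all the rows are values of monic polynomials. *)
have C_vdm : C.['X_j] * cof j = vdm L k.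
  (* Only the term [j] of the expansion along the top row is nonzero. *)
  have := C_row (fun=> 1); rewrite mul1r => <-.
  under eq_bigr => l _ do rewrite mul1r.
  rewrite -(det_toprow (fun l => C.['X_l])).
  rewrite -(vdm_det_monic (p := fun i : 'I_k =>
    if i == rev_ord i0 then C else facpoly (fun l => (y l)%:MP) i)) => [||i].
  - congr (\det _); apply/matrixP => a b; rewrite !mxE (inj_eq rev_ord_inj).
    by case: eqP => // _; rewrite -facpowE.
  - by move=> i; case: eqP => _; [exact: C_monic | exact: facpoly_monic].
  - case: eqP => [->|_]; last exact: size_facpoly.
    by rewrite size_C /= subn1 prednK.
exists (fun i => C`_i).
  by move/monicP: C_monic; rewrite /lead_coef size_C /= subn1.
apply: (@vdm_lreg L k); rewrite mulrC [RHS]mulrC mulr_suml.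
under [RHS]eq_bigr => i _ do rewrite -mulrA fhom_det det_toprow mulr_sumr.
rewrite exchange_big /= -C_vdm -(C_row (fun l => facpow y l n)).
apply: eq_bigr => l _.
rewrite (@horner_coef_wide _ k) ?size_C // mulr_sumr mulr_suml.
apply: eq_bigr => i _.
have -> : (n - k + i.+1 + k.-1 = n + i)%N by move: k_gt0 kn; lia.
by rewrite facpow_shift; ring.
Qed.

End OneRowRelations.

Section QuantumRelations.
Variables (n k : nat) (hk : (1 <= k <= n - 1)%N).
Local Notation L := (qring n).
Local Notation y := (@ypar n).
Local Notation A := {mpoly L[k]}.
Local Notation kn := (k_le_n hk).

Lemma ypar_ge i : (n <= i)%N -> y i = 0.
Proof. by move=> ni; rewrite /ypar insubF // ltnNge ni. Qed.

(** Among the generators only [h_n + (-1)^k q] involves [q], and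
    [facpow_fhom] takes it with the coefficient 1. *)
Lemma facpow_qgen (j : 'I_k) :
  exists c : 'I_k -> A, facpow y j n + ((-1) ^+ k * qpar n)%:MP
    = \sum_(i < k) c i * sym_val (qgen n i).
Proof.
have k_gt0 : (0 < k)%N by case/andP: hk.
have [c c_last ->] := facpow_fhom k_gt0 kn (@ypar_ge) j.
have symD (f g : sympoly L k) : sym_val (f + g) = sym_val f + sym_val g by [].
exists c; rewrite /qgen; under [RHS]eq_bigr => i _ do rewrite symD mulrDr.
rewrite big_split /=; congr (_ + _).
rewrite (bigD1 (rev_ord (Ordinal k_gt0))) //= big1 ?addr0 => [|i il].
  rewrite subn1 prednK // eqxx c_last.
  by rewrite mul1r -[RHS]/(_ *: (1 : A)) -mul_mpolyC mulr1.
case: eqP => [ik|_]; last by rewrite mulr0.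
by case/eqP: il; apply: val_inj => /=; move: ik; lia.
Qed.

(** The class in [qH] of the antisymmetrization of a polynomial: as a
    function of tensors, this is [wedge] followed by the identification of the
    exterior power with [qH] ([wedge_to_qH_wedge]). *)
Definition qfunctional (p : A) : qH hk := qclass hk (divdiff p).
Local Notation K := qfunctional.

Lemma qfunctional_is_linear : linear K.
Proof. by move=> c p p'; rewrite /qfunctional divdiff_is_linear rmorphD /= qclass_scale. Qed.

HB.instance Definition _ :=
  GRing.isLinear.Build L A (qH hk) *:%R qfunctional qfunctional_is_linear.

Lemma qfunctionalZ c p : K (c *: p) = c *: K p.
Proof. by rewrite /qfunctional linearZ /= qclass_scale. Qed.

Lemma qfunctional_symM (f : sympoly L k) p : K (sym_val f * p) = qclass hk f * K p.
Proof. by rewrite /qfunctional divdiff_symM rmorphM /=. Qed.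

Lemma qclass_qgen (i : 'I_k) : qclass hk (qgen n i) = 0.
Proof.
rewrite -[RHS](rmorph0 (qclass hk)); apply/eqP.
rewrite -[_ == _]/(qgen n i == 0 %[mod {ideal_quot qidealr hk}])%qT.
rewrite -Quotient.idealrBE subr0; apply/asboolP.
exists (fun j => (j == i)%:R); rewrite (bigD1 i) //= eqxx mul1r.
by rewrite big1 ?addr0 // => j /negbTE->; rewrite mul0r.
Qed.

Lemma qfunctional_facpow (j : 'I_k) p :
  K (p * facpow y j n) = K (p * ((-1) ^+ (k - 1) * qpar n)%:MP).
Proof.
apply/eqP; rewrite -subr_eq0 -linearB /= -mulrBr; apply/eqP.
have [c cE] := facpow_qgen j.
have -> : facpow y j n - ((-1) ^+ (k - 1) * qpar n)%:MP
    = \sum_(i < k) c i * sym_val (qgen n i).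
  by rewrite -cE -mpolyCN -mulNr -mulN1r -exprS subn1 prednK //; case/andP: hk.
rewrite mulr_sumr linear_sum big1 // => i _.
rewrite mulrA mulrC; transitivity (qclass hk (qgen n i) * K (p * c i)).
  exact: qfunctional_symM.
by rewrite qclass_qgen mul0r.
Qed.

End QuantumRelations.

(** * The quantised Chern roots as multiplications *)

Section Updates.
Variables n k : nat.
Implicit Types (a : multi n k) (i : 'I_k) (b : 'I_n).

Lemma upd_same a i b : upd a i b i = b.
Proof. by rewrite ffunE eqxx. Qed.

Lemma upd_updK a i b : upd (upd a i b) i (a i) = a.
Proof. by apply/ffunP => j; rewrite !ffunE; case: eqP => [->|]. Qed.

(** Exchanging the value of [a] at [i] with [b] is an involution of the
    pairs [(a, b)]. *)
Lemma sum_upd (V : nmodType) i (G : multi n k -> multi n k -> V) :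
  \sum_a \sum_(b < n) G a (upd a i b) = \sum_a \sum_(b < n) G (upd a i b) a.
Proof.
rewrite !pair_bigA /=.
pose h (p : multi n k * 'I_n) := (upd p.1 i p.2, p.1 i).
have hK : involutive h by move=> [a b]; rewrite /h /= upd_updK upd_same.
rewrite (reindex_inj (inv_inj hK)) /=; apply: eq_bigr => -[a b] _ /=.
by rewrite upd_updK.
Qed.

End Updates.

Lemma facmono_upd (L : comNzRingType) (y : nat -> L) n k (a : multi n k) i b :
  facmono y (fun j => upd a i b j)
    = facpow y i b * \prod_(j | j != i) facpow y j (a j).
Proof.
rewrite /facmono (bigD1 i) //= upd_same; congr (_ * _).
by apply: eq_bigr => j ji; rewrite ffunE (negbTE ji).
Qed.

Section ChernRoots.
Variables (L : comNzRingType) (y : nat -> L) (n k : nat) (c : L).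
Local Notation A := {mpoly L[k]}.
Variables (M : lmodType L) (K : {linear A -> M}).
Hypothesis K_facpow : forall i p, K (p * facpow y i n) = K (p * c%:MP).

(** The quantised Chern root, with an arbitrary corner [c] in place of
    [(-1)^(k-1) q]. *)
Definition root_mx : 'M[L]_n :=
  \matrix_(i, j) (c *+ ((val i == 0) && (val j == n - 1))%N
                  + (val i == (val j).+1)%:R + y i *+ (i == j)).

(** The recursion [(x|y)^(j+1) = (x|y)^j (x - y_(j+1))] says that the
    matrix multiplies by [x] in the basis of the factorial powers.  The last
    column is the exception, where [(x|y)^n] leaves the basis and [c] takes its
    place. *)
Lemma root_mx_column (i : 'I_k) (j : 'I_n) :
  \sum_(b < n) root_mx b j *: facpow y i b
    = 'X_i * facpow y i j + (if j.+1 == n then c%:MP - facpow y i n else 0).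
Proof.
have facpowS m : facpow y i m.+1 = facpow y i m * ('X_i - (y m)%:MP).
  by rewrite /facpow big_ord_recr.
have E (b : 'I_n) : root_mx b j *: facpow y i b
    = (if (b == 0 :> nat) && (j.+1 == n) then c%:MP else 0)
      + (if b == j.+1 :> nat then facpow y i j.+1 else 0)
      + (if b == j then (y j)%:MP * facpow y i j else 0).
  rewrite mxE !scalerDl; congr (_ + _ + _).
  - have -> : (val j == (n - 1)%N) = (j.+1 == n) by have := ltn_ord j; rewrite /=; lia.
    case: eqP => [->|_] /=; last by rewrite scale0r.
    case: eqP => _ /=; last by rewrite scale0r.
    by rewrite mulr1n /facpow big_ord0 -mul_mpolyC mulr1.
  - by case: eqP => [->|_]; rewrite ?scale1r ?scale0r.
  - by case: eqP => [->|_]; rewrite ?mulr1n ?scale0r // mul_mpolyC.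
under eq_bigr => b _ do rewrite E.
rewrite !big_split /=.
rewrite -[X in _ + X]big_mkcond big_pred1_eq.
have [jn|jn] := eqVneq j.+1 n.
  rewrite [X in _ + X + _]big1 => [|b _]; last first.
    by case: eqP => // bj; have := ltn_ord b; rewrite bj jn ltnn.
  have n0 : (0 < n)%N by rewrite -jn.
  rewrite (bigD1 (Ordinal n0)) //= big1 => [|b]; last first.
    by rewrite -val_eqE /= => /negbTE->.
  have -> : facpow y i n = facpow y i j.+1 by rewrite jn.
  by rewrite facpowS !addr0; ring.
rewrite big1 ?add0r => [|b _]; last by rewrite andbF.
have j1 : (j.+1 < n)%N by rewrite ltn_neqAle jn ltn_ord.
rewrite (bigD1 (Ordinal j1)) //= eqxx big1 => [|b]; last first.
  by rewrite -val_eqE /= => /negbTE->.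
by rewrite facpowS; ring.
Qed.

(** A functional [K] that does not distinguish [(x_i|y)^n] from [c] does
    not see the exception of [root_mx_column]. *)
Lemma root_mx_act (i : 'I_k) (t : multi n k -> L) p :
  K (p * \sum_(a : multi n k)
           (\sum_(b < n) root_mx (a i) b * t (upd a i b)) *: facmono y (fun j => a j))
    = K (p * 'X_i * \sum_(a : multi n k) t a *: facmono y (fun j => a j)).
Proof.
pose mono (a : multi n k) := facmono y (fun j => a j).
have -> : \sum_(a : multi n k) (\sum_(b < n) root_mx (a i) b * t (upd a i b)) *: mono a
    = \sum_(a : multi n k) t a *: \sum_(b < n) root_mx b (a i) *: mono (upd a i b).
  transitivity (\sum_(a : multi n k) \sum_(b < n)
      (root_mx (a i) (upd a i b i) * t (upd a i b)) *: mono a).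
    apply: eq_bigr => a _; rewrite scaler_suml; apply: eq_bigr => b _.
    by rewrite upd_same.
  rewrite (sum_upd i (fun a a' => (root_mx (a i) (a' i) * t a') *: mono a)).
  apply: eq_bigr => a _; rewrite scaler_sumr; apply: eq_bigr => b _.
  by rewrite upd_same scalerA mulrC.
rewrite !mulr_sumr !linear_sum; apply: eq_bigr => a _ /=.
rewrite -!scalerAr !linearZ /=; congr (_ *: _); rewrite -/(mono a).
pose others := \prod_(j | j != i) facpow y j (a j).
have -> : mono a = facpow y i (a i) * others by rewrite /mono /facmono (bigD1 i).
have -> : \sum_(b < n) root_mx b (a i) *: mono (upd a i b)
    = (\sum_(b < n) root_mx b (a i) *: facpow y i b) * others.
  rewrite mulr_suml; apply: eq_bigr => b _.
  by rewrite /mono facmono_upd scalerAl.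
rewrite root_mx_column mulrDl mulrDr linearD /= [X in _ + X](_ : _ = 0) ?addr0.
  by congr (K _); rewrite !mulrA.
case: eqP => _; last by rewrite mul0r mulr0 linear0.
rewrite mulrBl mulrBr linearB /=; apply/eqP; rewrite subr_eq0; apply/eqP.
by rewrite ![_ * others]mulrC !mulrA K_facpow.
Qed.

End ChernRoots.

(** The coordinates of [wedge] are read off by collecting the multi-indices
    according to their increasing rearrangement; the others, having a repeated
    entry, are killed by the antisymmetrization. *)
Lemma divdiff_wedge (L : comNzRingType) (y : nat -> L) n k (kn : (k <= n)%N)
    (M : lmodType L) (J : {linear sympoly L k -> M}) (t : multi n k -> L) :
  J (divdiff (\sum_(a : multi n k) t a *: facmono y (fun j => a j)))
    = \sum_(w : grass n k)
        (\sum_(s : 'S_k) (-1) ^+ s * t [ffun j => val w (widen_ord kn (s j))])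
        *: J (schubert y k (val w)).
Proof.
rewrite !linear_sum /=.
rewrite (bigID (fun a : multi n k => injectiveb a)) /= [X in _ + X]big1 ?addr0; last first.
  move=> a /injectivePn[i [j ij aij]].
  rewrite !linearZ /= (divdiff_facmono_repeat (e := fun j => a j) y ij) ?aij //.
  by rewrite linear0 scaler0.
rewrite (injective_decomposition kn) (big_sub (fun w => grassmannian k w)) /=.
apply: eq_bigr => w _; rewrite scaler_suml; apply: eq_bigr => s _.
rewrite linearZ /= linearZ /= mulrC -scalerA; congr (_ *: _).
rewrite -(divdiff_schubert y kn (valP w)) -linearZ -divdiff_facmono_perm.
congr (J (divdiff _)); apply: eq_bigr => i _; by rewrite ffunE.
Qed.

Section PolynomialAction.
Variables (L : comNzRingType) (k : nat) (V M : lmodType L) (v0 : V) (v0_neq0 : v0 != 0).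
Local Notation A := {mpoly L[k]}.
Variables (P : {linear V -> A}) (K : {linear A -> M}).
Local Notation E := (lend v0_neq0).

(** The factor [r] makes the property stable under composition
    ([acts_asM]), although [K] itself is not multiplicative: it expresses an
    equality modulo the largest ideal of [A] on which [K] vanishes. *)
Definition acts_as (T : E) (p : A) := forall r v, K (r * P (T v)) = K (r * p * P v).

Lemma acts_as1 : acts_as 1 1.
Proof. by move=> r v; rewrite mulr1. Qed.

Lemma acts_asM T p T' p' : acts_as T p -> acts_as T' p' -> acts_as (T * T') (p * p').
Proof. by move=> hT hT' r v; rewrite lend_mulE hT hT' mulrA. Qed.

Lemma acts_as0 : acts_as 0 0.
Proof.
move=> r v; have -> : (0 : E) v = 0 by [].
by rewrite linear0 !mulr0 mul0r.
Qed.

Lemma acts_asD T p T' p' : acts_as T p -> acts_as T' p' -> acts_as (T + T') (p + p').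
Proof.
move=> hT hT' r v; have -> : (T + T') v = T v + T' v by [].
by rewrite linearD !mulrDr mulrDl !linearD /= hT hT'.
Qed.

Lemma acts_as_scalar c : acts_as c%:A c%:MP.
Proof.
move=> r v; have -> : (c%:A : E) v = c *: v by [].
by rewrite linearZ /= -mul_mpolyC mulrA.
Qed.

Lemma acts_as_mmap (h : 'I_k -> E) (f : A) :
  (forall i, acts_as (h i) 'X_i) -> acts_as (mmap (fun c : L => c%:A) h f) f.
Proof.
move=> hX; rewrite {2}[f]mpolyE /mmap.
apply: (big_ind2 acts_as acts_as0 acts_asD) => m _.
rewrite -mul_mpolyC; apply: acts_asM; first exact: acts_as_scalar.
rewrite mpolyXE_id /mmap1; apply: (big_ind2 acts_as acts_as1 acts_asM) => i _.
elim: (m i) => [|e IH]; first by rewrite !expr0; exact: acts_as1.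
by rewrite !exprS; apply: acts_asM.
Qed.

End PolynomialAction.

(** * Symmetric polynomials in the quantised Chern roots *)

Section ChernRootAction.
Variables (n k : nat) (hk : (1 <= k <= n - 1)%N).
Local Notation L := (qring n).
Local Notation y := (@ypar n).
Local Notation A := {mpoly L[k]}.
Local Notation K := (qfunctional hk).

Definition tensor_poly (t : tensor n k) : A :=
  \sum_(a : multi n k) (t a : L) *: facmono y (fun j => a j).

Lemma tensor_poly_is_linear : linear tensor_poly.
Proof.
move=> c t t'; rewrite /tensor_poly scaler_sumr -big_split.
by apply: eq_bigr => a _; rewrite !ffunE /= scalerDl scalerA.
Qed.

HB.instance Definition _ :=
  GRing.isLinear.Build L (tensor n k) A *:%R tensor_poly tensor_poly_is_linear.

Lemma tensor_polyZ c t : tensor_poly (c *: t) = c *: tensor_poly t.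
Proof. by rewrite linearZ. Qed.

(** The tensors seen through [qfunctional] are a module on which [X^q_i]
    is the multiplication by ['X_i]. *)
Lemma symX_act (f : sympoly L k) t :
  K (tensor_poly (symX hk f t)) = qclass hk f * K (tensor_poly t).
Proof.
have X_act i : acts_as (V := tensor n k) tensor_poly K (Xact hk i : lend (vten_neq0 hk)) 'X_i.
  move=> r v.
  apply: etrans (root_mx_act (n := n) (y := y) (K := K) (qfunctional_facpow hk) i (fun a => v a) r).
  congr (K (r * _)); apply: eq_bigr => a _; congr (_ *: _); exact: ffunE.
have := acts_as_mmap (sym_val f) X_act 1 t; rewrite !mul1r => symX_K.
apply: etrans symX_K _; exact: qfunctional_symM.
Qed.

Lemma qclass_is_linear : linear (qclass hk).
Proof. by move=> c p p'; rewrite rmorphD /= qclass_scale. Qed.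

Lemma wedge_to_qH_wedge t : wedge_to_qH hk (wedge hk t) = K (tensor_poly t).
Proof.
apply/esym.
apply: etrans (divdiff_wedge y (k_le_n hk) (mklin qclass_is_linear) (fun a => t a : L)) _.
apply: eq_bigr => w _; congr (_ *: _).
apply/esym; apply: etrans (ffunE _ _) _.
apply: eq_bigr => s _; congr (_ * t _).
by apply/ffunP => j; rewrite !ffunE.
Qed.

Lemma tensor_poly_vten (a : multi n k) : tensor_poly (vten a) = facmono y (fun j => a j).
Proof.
rewrite /tensor_poly (bigD1 a) //= big1 => [|b ab].
  by rewrite ffunE eqxx scale1r addr0.
by rewrite ffunE eq_sym (negbTE ab) scale0r.
Qed.

Lemma qfunctional_lift u : K (tensor_poly (wedge_lift hk u)) = wedge_to_qH hk u.
Proof.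
rewrite /wedge_lift (linear_sum tensor_poly) (linear_sum K).
apply: eq_bigr => w _.
transitivity ((u w : L) *: K (tensor_poly (vten (vindex hk (val w))))).
  rewrite -qfunctionalZ; congr K; exact: tensor_polyZ.
congr (_ *: _); rewrite tensor_poly_vten; congr (qclass hk _).
rewrite -(divdiff_schubert y (k_le_n hk) (valP w)); congr divdiff.
by apply: eq_bigr => i _; rewrite ffunE.
Qed.

Lemma wedge_to_qH_symX f u :
  wedge_to_qH hk (symX_wedge hk f u) = qclass hk f * wedge_to_qH hk u.
Proof.
apply: etrans (wedge_to_qH_wedge _) _; apply: etrans (symX_act _ _) _.
by congr (_ * _); exact: qfunctional_lift.
Qed.

Lemma sigma1 : sigma hk 1%g = 1.
Proof.
apply: etrans (congr1 (qclass hk) (schubert1 y (k_le_n hk))) _.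
exact: rmorph1.
Qed.

Lemma grassmannian1 : grassmannian k (1%g : 'S_n).
Proof. by apply/(grassmannianP (k_le_n hk)) => i j ij _; rewrite !perm1. Qed.

(** The image of [wedge_to_qH] contains 1, the class of the identity
    permutation, and is stable under multiplication by every class according to
    [wedge_to_qH_symX]. *)
Lemma wedge_to_qH_surj x : exists u, wedge_to_qH hk u = x.
Proof.
pose w1 : grass n k := exist _ 1%g grassmannian1.
pose u1 : wedge_power n k := [ffun w => (w == w1)%:R].
have u1E : wedge_to_qH hk u1 = 1.
  rewrite /wedge_to_qH (bigD1 w1) //= big1 => [|w ww1].
    rewrite ffunE eqxx scale1r addr0; exact: sigma1.
  rewrite ffunE (negbTE ww1); exact: scale0r.
have [p <-] : exists p, qclass hk p = x.
  exists (generic_quotient.repr (x : {ideal_quot qidealr hk})).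
  exact: generic_quotient.reprK.
exists (symX_wedge hk p u1).
by apply: etrans (wedge_to_qH_symX _ _) _; rewrite u1E mulr1.
Qed.

(** The multiplication by the class of [f] is conjugate to [symX_wedge f],
    and surjectivity leaves no other endomorphism with this property. *)
Lemma symX_qHE f : symX_qH hk f = qmul (qclass hk f).
Proof.
have spec : forall u, symX_qH hk f (wedge_to_qH hk u) = wedge_to_qH hk (symX_wedge hk f u).
  apply: (classical_sets.xgetPex (0 : qEnd hk) (P := fun A : qEnd hk => forall u,
    A (wedge_to_qH hk u) = wedge_to_qH hk (symX_wedge hk f u))).
  exists (qmul (qclass hk f)) => u; exact/esym/wedge_to_qH_symX.
apply: linear_ext => x; have [u <-] := wedge_to_qH_surj x.
apply: etrans (spec u) _; exact: wedge_to_qH_symX.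
Qed.

End ChernRootAction.

(** * The product of the Chern polynomials *)

Lemma map_mpoly_inj (R S : nzRingType) (f : {rmorphism R -> S}) m :
  injective f -> injective (map_mpoly f : {mpoly R[m]} -> {mpoly S[m]}).
Proof.
move=> f_inj p q /mpolyP E; apply/mpolyP => d; apply: f_inj.
by have := E d; rewrite !mcoeff_map_mpoly.
Qed.

Lemma map_mpoly_chern (R S : nzRingType) (f : {rmorphism R -> S}) m k
    (c : nat -> R) (i : 'I_m) :
  map_mpoly f (\sum_(r < k.+1) (c r)%:MP * 'X_i ^+ (k - r))
    = \sum_(r < k.+1) (f (c r))%:MP * 'X_i ^+ (k - r).
Proof.
rewrite rmorph_sum; apply: eq_bigr => r _.
by rewrite rmorphM rmorphXn /= map_mpolyX map_mpolyC.
Qed.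

Lemma map_mpoly_scalars (R S T : nzRingType) (f : {rmorphism R -> S})
    (g : {rmorphism S -> T}) (h : {rmorphism R -> T}) m c (p : {mpoly R[m]}) :
    (forall a, g (f a) = h a) ->
  map_mpoly g (c%:MP * map_mpoly f p) = (g c)%:MP * map_mpoly h p.
Proof.
move=> gf; rewrite rmorphM /= map_mpolyC; congr (_ * _).
by apply/mpolyP => d; rewrite !mcoeff_map_mpoly /= gf.
Qed.

(** Expand the product over the subsets of variables, then collect the
    subsets by size. *)
Lemma prod_add_mesym (L : comNzRingType) k m (b : 'I_m) :
  \prod_(a < k) ('X_b + ('X_a)%:MP)
    = \sum_(r < k.+1) (mesym k L r)%:MP * 'X_b ^+ (k - r)
    :> {mpoly {mpoly L[k]}[m]}.
Proof.
under eq_bigr => a _ do rewrite addrC.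
rewrite bigA_distr.
rewrite (partition_big (fun J : {set 'I_k} => inord #|J| : 'I_k.+1) predT) //=.
apply: eq_bigr => r _; rewrite rmorph_sum mulr_suml.
have le_k (J : {set 'I_k}) : (#|J| < k.+1)%N.
  by rewrite ltnS -[X in (_ <= X)%N](card_ord k) max_card.
apply: eq_big => [J|J /eqP <-]; first by rewrite -val_eqE /= inordK.
rewrite inordK // (bigID (mem J)) /= rmorph_prod; congr (_ * _).
  by apply: eq_bigr => a ->.
rewrite (eq_bigr (fun=> 'X_b)) => [|a /negbTE-> //]; rewrite prodr_const.
congr (_ ^+ _); rewrite -[RHS]/(k - #|J|)%N -[X in (X - _)%N](card_ord k).
by rewrite -(cardC (mem J)) addKn; apply: eq_card => i; rewrite !inE.
Qed.

Section SymmetricDualCauchy.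
Variables (L : comNzRingType) (y : nat -> L) (k m : nat).
Local Notation S := (sympoly L k).

(** [dual_cauchy] has its coefficients in the polynomials in [xi]; both
    sides come from symmetric ones, and the inclusion is injective. *)
Lemma dual_cauchy_sympoly n : n = (k + m)%N ->
  \prod_(b < m) \sum_(r < k.+1) (sym_elem L k r)%:MP * 'X_b ^+ (k - r)
    = \sum_(w : 'S_n | grassmannian k w)
        (schubert y k w)%:MP
        * map_mpoly (in_alg S) (sym_val (schubert (fun i => - y i) m (wstar k w)))
    :> {mpoly S[m]}.
Proof.
move=> ->.
have [v vE] : exists v : {rmorphism S -> {mpoly L[k]}}, forall p, v p = sym_val p.
  by exists val.
have v_inj : injective v by move=> p q; rewrite !vE; exact: val_inj.
apply: (map_mpoly_inj v_inj); rewrite rmorph_prod rmorph_sum.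
transitivity (\prod_(b < m) \prod_(a < k) ('X_b + ('X_a)%:MP : {mpoly {mpoly L[k]}[m]})).
  apply: eq_bigr => b _.
  apply: etrans (map_mpoly_chern v _ (sym_elem L k) b) _.
  by rewrite prod_add_mesym; apply: eq_bigr => r _; rewrite vE.
rewrite (dual_cauchy y); apply: eq_bigr => w _.
apply/esym; apply: etrans (map_mpoly_scalars (h := @mpolyC k L) _ _ _) _ => [a|].
  rewrite vE -[LHS]/(_ *: (1 : {mpoly L[k]})) -mul_mpolyC; exact: mulr1.
by rewrite vE.
Qed.

End SymmetricDualCauchy.

Lemma horner_map_mpolyC (E : nzRingType) m k (c : nat -> E) (i : 'I_m) :
  (map_poly (@mpolyC m E) (\sum_(r < k.+1) c r *: 'X^(k - r))).['X_i]
    = \sum_(r < k.+1) (c r)%:MP * 'X_i ^+ (k - r).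
Proof.
rewrite rmorph_sum horner_sum; apply: eq_bigr => r _ /=.
by rewrite map_polyZ map_polyXn hornerZ hornerXn.
Qed.

Section QuantumMultiplication.
Variables (n k : nat) (hk : (1 <= k <= n - 1)%N).
Local Notation S := (sympoly (qring n) k).

(** As a ring morphism from the symmetric polynomials to the endomorphisms
    of [qH], this transports identities between polynomials to operators. *)
Definition qaction (f : S) : qEnd hk := qmul (qclass hk f).

Lemma qaction_zmod : zmod_morphism qaction.
Proof.
move=> f g; apply: linear_ext => x; rewrite /= rmorphB; exact: mulrBl.
Qed.

Lemma qaction_monoid : monoid_morphism qaction.
Proof.
split=> [|f g]; apply: linear_ext => x /=.
  by rewrite rmorph1; exact: mul1r.
by rewrite rmorphM; exact/esym/mulrA.
Qed.

HB.instance Definition _ :=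
  GRing.isZmodMorphism.Build S (qEnd hk) qaction qaction_zmod.
HB.instance Definition _ :=
  GRing.isMonoidMorphism.Build S (qEnd hk) qaction qaction_monoid.

Lemma qaction_scalar c : qaction c%:A = c%:A.
Proof. by apply: linear_ext. Qed.

End QuantumMultiplication.

Theorem proposition1p3 (n k : nat) (hn : (2 <= n)%N) (hk : (1 <= k <= n - 1)%N) :
  \prod_(i < n - k) chern_at hk i =
  \sum_(w : 'S_n | grassmannian k w)
     (symX_qH hk (schubert (@ypar n) k w))%:MP *
     map_mpoly (in_alg (qEnd hk))
       (sym_val (schubert (fun i => - ypar n i) (n - k) (wstar k w))).
Proof.
have nE : n = (k + (n - k))%N by rewrite subnKC // (k_le_n hk).
have := dual_cauchy_sympoly (@ypar n) nE.
move/(congr1 (map_mpoly (@qaction n k hk))).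
rewrite rmorph_prod rmorph_sum /= => E.
apply: etrans (etrans _ E) _; [apply: eq_bigr => i _|apply: eq_bigr => w _].
  apply: etrans (horner_map_mpolyC _ (fun r => qmul (chern hk r)) i) _.
  exact/esym/(map_mpoly_chern (@qaction n k hk) k (sym_elem (qring n) k) i).
rewrite symX_qHE; apply: map_mpoly_scalars => c; exact: qaction_scalar.
Qed.
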